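(* Let $K$ be a number field and let $b\in K$ with $b\neq 0,-4$. Let $E_b/K$ be the elliptic curve $y^2=(x^2+b)(x+2)$. If $K$ contains $\sqrt{-1}$, then there exist infinitely many linearly disjoint (over $K$) $C_4$-extensions $L_1,L_2,\ldots$ of $K$ such that $\mathrm{rank}\,E_b(L_i)\ge \mathrm{rank}\,E_b(K)+2$ for every $i$.
   Context: $C_4$ is the cyclic group of order 4; a $C_4$-extension of $K$ is a finite Galois extension $L/K$ with Galois group isomorphic to $C_4$. $\mathrm{rank}\,E(L)$ is the rank of the Mordell–Weil group $E(L)$. *)

(* Defs.v *)
From HB Require Import structures.
From mathcomp Require Import all_boot all_order all_algebra all_fingroup all_solvable all_field.
From mathcomp Require Import boolp classical_sets constructive_ereal.
From mathcomp Require Import ring.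

Set Implicit Arguments.
Unset Strict Implicit.
Unset Printing Implicit Defensive.

Import GRing.Theory.
Local Open Scope ring_scope.

Section Curve.

Variables (F : fieldType) (b : F).

(* [None] is the point at infinity; y^2 = (x^2 + b)(x + 2) has Weierstrass
   form y^2 = x^3 + 2 x^2 + b x + 2 b. *)
Definition on_curve (p : option (F * F)) : bool :=
  if p is Some (x, y) then y ^+ 2 == (x ^+ 2 + b) * (x + 2) else true.

(* The set E_b(F). *)
Record ec_point := ECPoint { ec_val : option (F * F); _ : on_curve ec_val }.

HB.instance Definition _ := [isSub for ec_val].

Definition ec_slope (x1 y1 x2 y2 : F) : F :=
  if x1 == x2 then (3 * x1 ^+ 2 + 4 * x1 + b) / (2 * y1)
  else (y2 - y1) / (x2 - x1).

Definition ec_add_val (p q : option (F * F)) : option (F * F) :=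
  match p, q with
  | None, _ => q
  | _, None => p
  | Some (x1, y1), Some (x2, y2) =>
      if (x1 == x2) && (y1 == - y2) then None
      else
        let l := ec_slope x1 y1 x2 y2 in
        let x3 := l ^+ 2 - 2 - x1 - x2 in
        Some (x3, l * (x1 - x3) - y1)
  end.

Definition ec_opp_val (p : option (F * F)) : option (F * F) :=
  if p is Some (x, y) then Some (x, - y) else None.

Lemma ec_opp_on_curve (p : ec_point) : on_curve (ec_opp_val (ec_val p)).
Proof. by case: p => [[[x y]|]] //=; rewrite sqrrN. Qed.

(* [l] is the slope of the line through the two points, and the hypothesis on
   [x2] says that [x2] is a root of (f(x) - (l (x - x1) + y1)^2) / (x - x1),
   where f(x) = (x^2 + b)(x + 2). *)
Lemma ec_third_on_curve (x1 y1 x2 l : F) :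
    y1 ^+ 2 = (x1 ^+ 2 + b) * (x1 + 2) ->
    x2 ^+ 2 + x2 * x1 + x1 ^+ 2 + 2 * (x2 + x1) + b
      - l ^+ 2 * (x2 - x1) - 2 * l * y1 = 0 ->
  let x3 := l ^+ 2 - 2 - x1 - x2 in
  (l * (x1 - x3) - y1) ^+ 2 = (x3 ^+ 2 + b) * (x3 + 2).
Proof.
move=> E1 E2 x3; apply/eqP; rewrite -subr_eq0; apply/eqP.
transitivity ((y1 ^+ 2 - (x1 ^+ 2 + b) * (x1 + 2)) - (x3 - x1) *
   (x2 ^+ 2 + x2 * x1 + x1 ^+ 2 + 2 * (x2 + x1) + b
      - l ^+ 2 * (x2 - x1) - 2 * l * y1)); first by rewrite /x3; ring.
by rewrite E1 E2 subrr mulr0 subr0.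
Qed.

Lemma ec_add_on_curve (p q : ec_point) :
  on_curve (ec_add_val (ec_val p) (ec_val q)).
Proof.
case: p q => [[[x1 y1]|] Hp] [[[x2 y2]|] Hq] //=.
case: ifP => // Hn; move: Hp Hq => /= /eqP E1 /eqP E2.
apply/eqP; apply: ec_third_on_curve => //.
rewrite /ec_slope; case: eqVneq Hn => [E12|Nx] /= Hn.
  have E3 : y1 = y2.
    apply/eqP; rewrite -subr_eq0; move: (subr_sqr y1 y2).
    rewrite E1 E2 E12 subrr => /esym/eqP; rewrite mulf_eq0 => /orP[//|].
    by rewrite (addr_eq0 y1 y2) Hn.
  have N2 : 2 * y1 != 0.
    by rewrite mulr_natl mulr2n {2}E3 (addr_eq0 y1 y2) Hn.
  rewrite -E12; set l := _ / _.
  have El : l * (2 * y1) = 3 * x1 ^+ 2 + 4 * x1 + b by rewrite /l divfK.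
  transitivity (3 * x1 ^+ 2 + 4 * x1 + b - l * (2 * y1)); first by ring.
  by rewrite El subrr.
have N : x2 - x1 != 0 by rewrite subr_eq0 eq_sym.
set l := _ / _.
have El : y2 = l * (x2 - x1) + y1 by rewrite /l divfK // subrK.
apply: (mulfI N); rewrite mulr0.
transitivity (((x2 ^+ 2 + b) * (x2 + 2) - (l * (x2 - x1) + y1) ^+ 2)
  - ((x1 ^+ 2 + b) * (x1 + 2) - y1 ^+ 2)); first by ring.
by rewrite -El -E1 -E2 !subrr.
Qed.

Definition ec_zero : ec_point := @ECPoint None isT.
Definition ec_opp (p : ec_point) : ec_point := ECPoint (ec_opp_on_curve p).
Definition ec_add (p q : ec_point) : ec_point := ECPoint (ec_add_on_curve p q).

Definition ec_zmul (m : int) (p : ec_point) : ec_point :=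
  match m with
  | Posz n => iter n (ec_add p) ec_zero
  | Negz n => ec_opp (iter n.+1 (ec_add p) ec_zero)
  end.

Definition ec_indep (r : nat) (p : 'I_r -> ec_point) : Prop :=
  forall m : 'I_r -> int,
    \big[ec_add/ec_zero]_(i < r) ec_zmul (m i) (p i) = ec_zero ->
    forall i, m i = 0.

Definition is_ec_rank (r : nat) : Prop :=
  (exists p : 'I_r -> ec_point, ec_indep p) /\
  (forall (s : nat) (p : 'I_s -> ec_point), ec_indep p -> (s <= r)%N).

(* The rank of E_b(F) in {0, 1, 2, ...} U {+oo}, i.e., the supremum of the
   sizes of Z-linearly independent families. The value +oo makes the function
   total; over a number field it never occurs, by the Mordell-Weil theorem. *)
Definition ec_rank : \bar int :=
  if pselect (exists r, is_ec_rank r) is left h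
  then (Posz (sval (cid h)))%:E else +oo%E.

End Curve.

Definition is_C4_extension (K : fieldType) (L : splittingFieldType K) : Prop :=
  galois 1 {: L} /\ 'Gal({: L} / 1) \isog Zp 4.

Section LinearDisjointness.

Variable Omega : fieldType.

Definition lin_indep_over (k : set Omega) (n : nat) (a : 'I_n -> Omega) : Prop :=
  forall c : 'I_n -> Omega, (forall j, k (c j)) ->
    \sum_(j < n) c j * a j = 0 -> forall j, c j = 0.

(* For subfields k <= A, B of Omega. *)
Definition linearly_disjoint (k A B : set Omega) : Prop :=
  forall (n : nat) (a : 'I_n -> Omega), (forall j, A (a j)) ->
    lin_indep_over k a -> lin_indep_over B a.

Definition generated_subfield (X : set Omega) : set Omega :=
  [set x | forall S : {pred Omega}, divring_closed S ->
             (forall y, X y -> y \in S) -> x \in S]%classic.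

(* A sequence of extensions A_0, A_1, ... of k is linearly disjoint over k when
   each A_n is linearly disjoint from the compositum k A_0 ... A_(n-1). *)
Definition linearly_disjoint_seq (k : set Omega) (A : nat -> set Omega) : Prop :=
  forall n, linearly_disjoint k (A n)
    (generated_subfield
       (k `|` [set x | exists i, (i < n)%N /\ A i x])%classic).

End LinearDisjointness.

(* Main.v *)
(** If v is not a square in K, put g = v^2 + (2 + b) v + 1, let z^4 = v g^2 and
    w = z^2 / g, so that w^2 = v.  As K contains i = sqrt(-1), L = K(z) is a
    C4-extension of K, with generator tau : z |-> i z, and
    P = (w + 1/w, (1 + w) z / w^2) is a point of E_b(L) with tau^2 P = - P.
    If P has infinite order, then P and tau P are independent of each other and
    of E_b(K).

    P has infinite order when v is 2-adically close to 0: by the duplication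
    formula 1/x(2 Q) is 4/x(Q) times a 2-adic unit when 1/x(Q) is 2-adically
    small, so the points 2^k P are pairwise distinct.

    L is linearly disjoint from a number field N containing K as soon as v is
    not a square in N.  Since N has finite degree, some prime p is not a square
    in N, and v = p 4^(k+1) meets both requirements for k large.

    The group axioms are obtained by mapping a point to the class of its
    maximal ideal in the coordinate ring F[X, Y] / (Y^2 - f(X)). *)

Require Import Defs.
From HB Require Import structures.
From mathcomp Require Import all_boot all_order all_algebra all_fingroup all_solvable all_field.
From mathcomp Require Import boolp classical_sets constructive_ereal.
From mathcomp Require Import ring zify.

Set Implicit Arguments.
Unset Strict Implicit.
Unset Printing Implicit Defensive.

Import Num.Theory GRing.Theory.
Local Open Scope ring_scope.

(** * Ideals and the group law *)

(** The point comes from the substitution x = w + 1/w: then x + 2 = (1 + w)^2 / w, while x^2 + b = g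
    / w^2 lies in K. So f(x) = g w ((1 + w) / w^2)^2, and a square root z of g w gives the ordinate.
    The norm of g w from K(w) to K is - v g^2; the quartic field K(z) is cyclic when this norm is v
    times a square, which is where sqrt(-1) enters. A field N containing K contains sqrt(-1) too, so
    over N as over K the polynomial X^4 - v g^2 is irreducible once v is a non-square.

    As L varies with v, infinite order has to be forced by the choice of v. Several primes may lie
    above 2, so the 2-adic argument is phrased without a valuation: it asks for a ring O in which 2
    is not invertible but every element of 1 + 2 O is. Since b may have powers of 2 in its
    denominator, v carries a power of 4 large enough to make v b even.

    For the group law, products of ideals are associative, so it is enough that the map from points
    to ideal classes turns addition into multiplication and is injective. Nonsingularity enters as a
    Bezout identity between f and f'. *)

Section Ideals.

Variable R : comNzRingType.
Implicit Types (I J M : R -> Prop) (x y z : R).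

Inductive iprod I J : R -> Prop :=
| iprod0 : iprod I J 0
| iprodD x y z : I x -> J y -> iprod I J z -> iprod I J (x * y + z).

Definition ideal I := I 0 /\ (forall a x y, I x -> I y -> I (a * x + y)).

Lemma iprod_add I J x y : iprod I J x -> iprod I J y -> iprod I J (x + y).
Proof.
move=> Hx Hy; elim: Hx => [|u v z Iu Jv _ IH]; first by rewrite add0r.
by rewrite -addrA; apply: iprodD.
Qed.

Lemma iprod_mul I J x y : I x -> J y -> iprod I J (x * y).
Proof. by move=> Ix Jy; rewrite -[_ * _]addr0; do 2?constructor. Qed.

Lemma iprod_sub I J M : ideal M -> (forall x y, I x -> J y -> M (x * y)) ->
  forall x, iprod I J x -> M x.
Proof.
move=> [M0 MD] IJM x; elim=> // u v z Iu Jv _ Mz.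
by rewrite -[u * v]mul1r; apply: MD => //; apply: IJM.
Qed.

Lemma iprodC I J : iprod I J = iprod J I.
Proof.
apply/funext=> x; apply/propext.
by split; elim=> [|u v z Iu Jv _ H]; rewrite 1?mulrC; constructor.
Qed.

Lemma iprodA I J M : iprod I (iprod J M) = iprod (iprod I J) M.
Proof.
apply/funext=> x; apply/propext; split.
  elim=> [|u v z Iu JMv _ IH]; first exact: iprod0.
  apply: iprod_add IH; elim: JMv => [|v1 v2 z' Jv Mv _ IH].
    by rewrite mulr0; constructor.
  by rewrite mulrDr mulrA; constructor=> //; apply: iprod_mul.
elim=> [|u v z IJu Mv _ IH]; first exact: iprod0.
apply: iprod_add IH; elim: IJu => [|v1 v2 z' Iv Jv _ IH].
  by rewrite mul0r; constructor.
by rewrite mulrDl -mulrA; constructor=> //; apply: iprod_mul.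
Qed.

Lemma iprod_ideal I J : ideal I -> ideal (iprod I J).
Proof.
move=> [I0 ID]; split=> [|a x y Hx Hy]; first exact: iprod0.
apply: iprod_add Hy; elim: Hx => [|u v z Iu Jv _ IH].
  by rewrite mulr0; constructor.
rewrite mulrDr mulrA; constructor=> //.
by rewrite -[a * u]addr0; apply: ID.
Qed.

Definition gen2 x y : R -> Prop := fun z => exists s t, z = s * x + t * y.
Definition princ x : R -> Prop := fun z => exists s, z = s * x.

Lemma gen2_ideal x y : ideal (gen2 x y).
Proof.
split=> [|a u v [s [t ->]] [s' [t' ->]]]; first by exists 0, 0; ring.
by exists (a * s + s'), (a * t + t'); ring.
Qed.

Lemma gen2l x y : gen2 x y x. Proof. by exists 1, 0; ring. Qed.
Lemma gen2r x y : gen2 x y y. Proof. by exists 0, 1; ring. Qed.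

Lemma princ_ideal x : ideal (princ x).
Proof.
split=> [|a u v [s ->] [t ->]]; first by exists 0; ring.
by exists (a * s + t); ring.
Qed.

Lemma princ_iprod x y : iprod (princ x) (princ y) = princ (x * y).
Proof.
apply/funext=> z; apply/propext; split.
  apply: (@iprod_sub _ _ (princ (x * y))); first exact: princ_ideal.
  by move=> _ _ [s ->] [t ->]; exists (s * t); ring.
move=> [s ->]; rewrite mulrA; apply: iprod_mul; first by exists s.
by exists 1; ring.
Qed.

Lemma iprod_princ1 I : ideal I -> iprod I (princ 1) = I.
Proof.
move=> idI; have [I0 ID] := idI; apply/funext=> z; apply/propext; split.
  apply: iprod_sub => // x _ Ix [s ->].
  by rewrite mulr1 mulrC -[_ * _]addr0; apply: ID.
by move=> Iz; rewrite -[z]mulr1; apply: iprod_mul => //; exists 1; ring.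
Qed.

Lemma iprod_princP h I z : ideal I -> iprod (princ h) I z ->
  exists2 g, I g & z = h * g.
Proof.
move=> [I0 ID]; elim=> [|_ v z' [s ->] Iv _ [g Ig ->]].
  by exists 0 => //; ring.
by exists (s * v + g); [apply: ID | ring].
Qed.

(** Equality of ideal classes with denominators cleared. Asking [h] and [k] to be regular makes the
    relation transitive over any commutative ring. *)
Definition ideal_equiv I J := exists h k, [/\ GRing.lreg h, GRing.lreg k &
  iprod (princ h) I = iprod (princ k) J].

Local Notation "I ~~ J" := (ideal_equiv I J) (at level 70).

Lemma ideal_equiv_refl I : I ~~ I.
Proof. by exists 1, 1; split=> //; apply: lreg1. Qed.

Lemma ideal_equiv_sym I J : I ~~ J -> J ~~ I.
Proof. by move=> [h [k [Hh Hk E]]]; exists k, h. Qed.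

Lemma ideal_equiv_trans I J M : I ~~ J -> J ~~ M -> I ~~ M.
Proof.
move=> [h [k [Hh Hk E]]] [h' [k' [Hh' Hk' E']]].
exists (h' * h), (k * k'); split; [exact: lregM | exact: lregM |].
rewrite -!princ_iprod -!iprodA E -E' !iprodA.
by congr (iprod _ _); rewrite iprodC.
Qed.

Lemma ideal_equiv_prod I J I' J' : I ~~ I' -> J ~~ J' ->
  iprod I J ~~ iprod I' J'.
Proof.
move=> [h [k [Hh Hk E]]] [h' [k' [Hh' Hk' E']]].
exists (h * h'), (k * k'); split; [exact: lregM | exact: lregM |].
rewrite -!princ_iprod -!iprodA (iprodA (princ h')) (iprodC (princ h') I).
rewrite -iprodA iprodA E E' -iprodA (iprodA I') (iprodC I').
by rewrite -!iprodA.
Qed.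

Lemma ideal_equiv_princ h : GRing.lreg h -> princ h ~~ princ 1.
Proof.
move=> Hh; exists 1, h; split=> //; first exact: lreg1.
by rewrite !princ_iprod mulrC.
Qed.

End Ideals.

(** * The affine coordinate ring and the ideals of its points *)

Section CoordinateRing.

Variable F : fieldType.

(* The pair (a, b) stands for a(X) + b(X) Y in F[X, Y] / (Y^2 - f(X)). *)
Definition coord_ring (f : {poly F}) : Type := ({poly F} * {poly F})%type.

Variable f : {poly F}.
Local Notation R := (coord_ring f).

HB.instance Definition _ := GRing.Zmodule.on R.

Definition coord_mul (g h : R) : R :=
  (g.1 * h.1 + g.2 * h.2 * f, g.1 * h.2 + g.2 * h.1).

Fact coord_mulA : associative coord_mul.
Proof. by move=> g h k; congr (_, _) => /=; ring. Qed.
Fact coord_mulC : commutative coord_mul.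
Proof. by move=> g h; congr (_, _) => /=; ring. Qed.
Fact coord_mul1 : left_id ((1, 0) : R) coord_mul.
Proof. by move=> [a c]; congr (_, _) => /=; ring. Qed.
Fact coord_mulD : left_distributive coord_mul +%R.
Proof. by move=> g h k; congr (_, _) => /=; ring. Qed.
Fact coord_1neq0 : ((1, 0) : R) != 0.
Proof. by apply/eqP=> -[] /eqP; rewrite oner_eq0. Qed.

HB.instance Definition _ := GRing.Zmodule_isComNzRing.Build R
  coord_mulA coord_mulC coord_mul1 coord_mulD coord_1neq0.

Definition cX (a : {poly F}) : R := (a, 0).
Definition cY : R := (0, 1).

Lemma coord_mulE (g h : R) : g * h = coord_mul g h. Proof. by []. Qed.

Lemma cXD a c : cX (a + c) = cX a + cX c.
Proof. by congr (_, _); rewrite /= ?addr0. Qed.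
Lemma cXM a c : cX (a * c) = cX a * cX c.
Proof. by rewrite coord_mulE; congr (_, _) => /=; ring. Qed.
Lemma cXN a : cX (- a) = - cX a.
Proof. by congr (_, _); rewrite /= ?oppr0. Qed.
Lemma cX1 : cX 1 = 1. Proof. by []. Qed.
Lemma cXn n : cX n%:R = n%:R.
Proof. by elim: n => // n IH; rewrite !mulrS cXD IH. Qed.
Lemma cY2 : cY * cY = cX f.
Proof. by rewrite coord_mulE; congr (_, _) => /=; ring. Qed.

Hypothesis size_f : size f = 4.

Definition cnorm (g : R) : {poly F} := g.1 ^+ 2 - g.2 ^+ 2 * f.

Lemma cnormM g h : cnorm (g * h) = cnorm g * cnorm h.
Proof. by rewrite coord_mulE /cnorm /coord_mul /=; ring. Qed.

(* deg a^2 is even while deg (c^2 f) is odd, so the two do not cancel. *)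
Lemma size_cnorm (g : R) : g.2 != 0 -> (3 < size (cnorm g))%N.
Proof.
case: g => a c /= c0; rewrite /cnorm /=.
have f0 : f != 0 by rewrite -size_poly_eq0 size_f.
have Sc : size (c ^+ 2 * f) = ((size c).*2 + 2)%N.
  rewrite size_mul ?expf_neq0 // expr2 size_mul // size_f.
  have : (0 < size c)%N by rewrite size_poly_gt0.
  by case: (size c) => // n _; rewrite -addnn; rewrite !addnS !addn0 !addSn.
have c1 : (0 < size c)%N by rewrite size_poly_gt0.
have S3 : (3 < size (c ^+ 2 * f)%R)%N.
  by rewrite Sc; case: (size c) c1 => // n _; rewrite doubleS !addSn addn2.
have [->|a0] := eqVneq a 0; first by rewrite expr0n /= sub0r size_polyN.
have Sa : size (a ^+ 2) = (size a).*2.-1 by rewrite expr2 size_mul // addnn.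
have odd_a : odd (size (a ^+ 2)%R).
  have : (0 < size a)%N by rewrite size_poly_gt0.
  by rewrite Sa; case: (size a) => // n _; rewrite doubleS /= odd_double.
have [lt|lt|E] := ltngtP (size (a ^+ 2)) (size (c ^+ 2 * f)).
- by rewrite addrC size_polyDl size_polyN.
- by rewrite size_polyDl ?size_polyN // (ltn_trans S3).
- by move: odd_a; rewrite E Sc addn2 /= odd_double.
Qed.

Lemma cnorm_eq0 (g : R) : cnorm g = 0 -> g = 0.
Proof.
move=> N0; have [c0|/size_cnorm] := eqVneq g.2 0; last by rewrite N0 size_poly0.
move: N0; rewrite /cnorm c0 expr0n /= mul0r subr0 => /eqP.
by rewrite expf_eq0 /= => /eqP a0; case: g a0 c0 => a c /= -> ->.
Qed.

Lemma coord_lreg (g : R) : g != 0 -> GRing.lreg g.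
Proof.
move=> g0; apply: mulrI0_lreg => h gh0.
have /eqP : cnorm g * cnorm h = 0.
  by rewrite -cnormM gh0 /cnorm expr0n /= mul0r subrr.
rewrite mulf_eq0 => /orP[] /eqP /cnorm_eq0 // E.
by rewrite E eqxx in g0.
Qed.

Definition cline (m : {poly F}) : R := cY - cX m.

Definition point_ideal (x y : F) : R -> Prop :=
  gen2 (cX ('X - x%:P)) (cline y%:P).

Definition ceval (x y : F) (g : R) : F := g.1.[x] + g.2.[x] * y.

Lemma point_ideal_eval x y g : y ^+ 2 = f.[x] -> point_ideal x y g ->
  ceval x y g = 0.
Proof.
move=> E [s [t ->]]; rewrite !coord_mulE /ceval /=.
by rewrite !hornerE /= -E; ring.
Qed.

(* If the ideal were generated by g, then the norm of g would divide
   (X - x)^2, which forces g to be a polynomial in X dividing Y - y. *)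
Lemma point_ideal_nprinc x y : y ^+ 2 = f.[x] ->
  ~ ideal_equiv (point_ideal x y) (princ 1).
Proof.
move=> E [h [k [Hh Hk Ehk]]].
rewrite princ_iprod mulr1 in Ehk.
have [g Ig kE] : exists2 g, point_ideal x y g & k = h * g.
  apply: iprod_princP; first exact: gen2_ideal.
  by rewrite Ehk; exists 1; rewrite mul1r.
have gP p : point_ideal x y p -> exists s, p = s * g.
  move=> Ip; have : iprod (princ h) (point_ideal x y) (h * p).
    by apply: iprod_mul => //; exists 1; rewrite mul1r.
  rewrite Ehk => -[s]; rewrite kE => Es; exists s; apply: Hh.
  by rewrite Es mulrCA.
have [s Es] := gP _ (gen2l _ _).
have [t Et] := gP _ (gen2r _ _).
have N : cnorm s * cnorm g = ('X - x%:P) ^+ 2.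
  by rewrite -cnormM -Es /cnorm /= expr0n /= mul0r subr0.
have c0 : g.2 = 0.
  apply/eqP; apply: contraT => /size_cnorm lt.
  have X0 : ('X - x%:P) ^+ 2 != 0 by rewrite expf_neq0 // polyXsubC_eq0.
  have: (size (cnorm g) <= size (('X - x%:P) ^+ 2)%R)%N.
    by apply: dvdp_leq => //; rewrite -N dvdp_mull.
  by rewrite size_exp_XsubC leqNgt lt.
have E2 : t.2 * g.1 = 1.
  move: Et; rewrite coord_mulE => /(congr1 snd) /=.
  by rewrite c0 mulr0 add0r subr0 => <-.
have := point_ideal_eval E Ig; rewrite /ceval c0 horner0 mul0r addr0 => H.
have := congr1 (horner^~ x) E2; rewrite hornerM H mulr0 hornerC => /esym/eqP.
by rewrite oner_eq0.
Qed.

Hypothesis two_neq0 : 2 != 0 :> F.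
Hypothesis f_sep : exists u v, u * f + v * f^`() = 1.

(** Squaring u f + v f' = 1 leaves a multiple of f plus v^2 f'^2, and 4 is invertible. This is how
    smoothness is used: [T] will be an ideal quotient that has to be the whole ring. *)
Lemma coord_ideal_full (T : R -> Prop) : ideal T ->
  T (4 * cX f) -> T (cX f^`() * cX f^`()) -> T 1.
Proof.
move=> [T0 TD] T4 Td; have [u [v E]] := f_sep.
have E1 : cX u * cX f + cX v * cX f^`() = 1 by rewrite -!cXM -cXD E cX1.
have E4 : cX (4^-1)%:P * 4 = 1.
  have -> : (4 : R) = cX 4%:P by rewrite -cXn raddfMn.
  rewrite -cXM -polyCM mulVf //.
  by rewrite (_ : 4 = 2 * 2) ?mulf_neq0 // -natrM.
have -> : 1 = (cX (4^-1)%:P * (cX u * cX u * cX f +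
   2 * cX u * cX v * cX f^`())) * (4 * cX f) +
   (cX v * cX v * (cX f^`() * cX f^`()) + 0).
  transitivity ((cX u * cX f + cX v * cX f^`()) ^+ 2).
    by rewrite E1 expr1n.
  set e := cX (4^-1)%:P in E4 *.
  transitivity ((e * 4) * (cX u * cX u * cX f +
    2 * cX u * cX v * cX f^`()) * cX f + cX v * cX v * (cX f^`() * cX f^`())).
    by rewrite E4; ring.
  by ring.
by apply: (TD) => //; apply: (TD).
Qed.

(** Modulo X - x the polynomial m is the constant m(x). Points on one line can thus share the
    generator Y - m. *)
Lemma point_idealE x y m : m.[x] = y ->
  point_ideal x y = gen2 (cX ('X - x%:P)) (cline m).
Proof.
move=> E; have /factor_theorem[q Eq] : root (m - y%:P) x.
  by rewrite /root !hornerE E subrr.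
have {Eq}Em : cX m = cX q * cX ('X - x%:P) + cX y%:P.
  by rewrite -cXM -cXD -Eq subrK.
apply/funext=> z; apply/propext; split=> -[s [t ->]].
  by exists (s + t * cX q), t; rewrite /cline Em; ring.
by exists (s - t * cX q), t; rewrite /cline Em; ring.
Qed.

(** One inclusion holds because (Y - y)(Y + y) = f - y^2 = (X - x) q. For the other, the ideal
    quotient [T] of the product by X - x contains X - x, Y - y, Y + y and q, hence 4 f and f' = q +
    q' (X - x), so it is the whole ring. *)
Lemma point_ideal_opp x y : y ^+ 2 = f.[x] ->
  iprod (point_ideal x y) (point_ideal x (- y)) = princ (cX ('X - x%:P)).
Proof.
move=> E; have /factor_theorem[q Eq] : root (f - (y ^+ 2)%:P) x.
  by rewrite /root !hornerE E subrr.
set c := 'X - x%:P in Eq *.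
have EY : cline y%:P * cline (- y)%:P = cX c * cX q.
  have Ef : cX f = cX q * cX c + cX y%:P * cX y%:P.
    by rewrite -!cXM -cXD -polyCM -expr2 -Eq subrK.
  rewrite /cline polyCN cXN.
  by transitivity (cY * cY - cX y%:P * cX y%:P); [|rewrite cY2 Ef]; ring.
set I := iprod _ _; have idI : ideal I by apply/iprod_ideal/gen2_ideal.
apply/funext=> z; apply/propext; split.
  apply: iprod_sub; first exact: princ_ideal.
  move=> _ _ [s [t ->]] [s' [t' ->]].
  exists (s * s' * cX c + s * t' * cline (- y)%:P + t * s' * cline y%:P +
    t * t' * cX q).
  transitivity (s * s' * cX c * cX c + s * t' * cline (- y)%:P * cX c
    + t * s' * cline y%:P * cX c + t * t' * (cline y%:P * cline (- y)%:P)).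
    by ring.
  by rewrite EY; ring.
pose T r := I (cX c * r).
have [I0 ID] := idI.
have idT : ideal T.
  split=> [|a u v Tu Tv]; rewrite /T ?mulr0 //.
  by rewrite mulrDr mulrCA; apply: ID.
have [T0 TD] := idT.
have T1 : T (cX c) by apply: iprod_mul; apply: gen2l.
have T2 : T (cline y%:P).
  by rewrite /T mulrC; apply: iprod_mul; [apply: gen2r | apply: gen2l].
have T3 : T (cline (- y)%:P).
  by apply: iprod_mul; [apply: gen2l | apply: gen2r].
have T4 : T (cX q).
  by rewrite /T -EY; apply: iprod_mul; apply: gen2r.
have T4f : T (4 * cX f).
  have -> : 4 * cX f = 2 * cY * cline y%:P + (2 * cY * cline (- y)%:P + 0).
    by rewrite -cY2 /cline polyCN cXN; ring.
  by apply: (TD) => //; apply: (TD).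
have Tf' : T (cX f^`()).
  have -> : cX f^`() = 1 * cX q + (cX q^`() * cX c + 0).
    have E' : f^`() = q + q^`() * c.
      rewrite -[f](subrK (y ^+ 2)%:P) Eq derivD derivC addr0 derivM.
      by rewrite derivXsubC mulr1 addrC.
    by rewrite E' cXD cXM; ring.
  by apply: (TD) => //; apply: (TD).
have : T 1.
  apply: coord_ideal_full => //.
  by rewrite -[_ * _]addr0; apply: (TD).
by rewrite /T mulr1 => Ic [s ->]; rewrite -[_ * _]addr0; apply: ID.
Qed.

(** The line Y = m(X) meets the curve in the three points, counted with multiplicity, and (Y - m)(Y
    + m) = f - m^2. The ideal quotient [T] of the product by Y - m contains Y + m, (Y - m)^2 and the
    products of two of the factors X - x_i; from these come 4 f and f'^2. Tangents are covered by
    the same computation. *)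
Lemma point_ideal_line x1 x2 x3 y1 y2 y3 m :
    m.[x1] = y1 -> m.[x2] = y2 -> m.[x3] = y3 ->
    ('X - x1%:P) * ('X - x2%:P) * ('X - x3%:P) = f - m ^+ 2 ->
  iprod (iprod (point_ideal x1 y1) (point_ideal x2 y2)) (point_ideal x3 y3)
    = princ (cline m).
Proof.
move=> E1 E2 E3; rewrite (point_idealE E1) (point_idealE E2) (point_idealE E3).
set c1 := 'X - x1%:P; set c2 := 'X - x2%:P; set c3 := 'X - x3%:P => Ec.
have EY : cX c1 * cX c2 * cX c3 = cline m * (cY + cX m).
  by rewrite -!cXM Ec cXD cXN expr2 cXM -cY2 /cline; ring.
set l := cline m in EY *; set I := iprod _ _.
have idI : ideal I by do 2!apply: iprod_ideal; apply: gen2_ideal.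
apply/funext=> z; apply/propext; split.
  rewrite /I -iprodA.
  apply: iprod_sub; first exact: princ_ideal.
  move=> u v Iu; move: v; apply: iprod_sub.
    split=> [|a v v' [r Er] [r' Er']]; first by exists 0; ring.
    by exists (a * r + r'); rewrite mulrDr mulrCA Er Er'; ring.
  move=> _ _ [s [t ->]] [s' [t' ->]]; case: Iu => s'' [t'' ->].
  exists (s'' * s * s' * (cY + cX m) + s'' * cX c1 * (s * cX c2 * t' +
     t * (s' * cX c3 + t' * l)) + t'' * (s * cX c2 + t * l) *
     (s' * cX c3 + t' * l)).
  transitivity (s'' * s * s' * (cX c1 * cX c2 * cX c3) +
     (s'' * cX c1 * (s * cX c2 * t' +
     t * (s' * cX c3 + t' * l)) + t'' * (s * cX c2 + t * l) *
     (s' * cX c3 + t' * l)) * l); first by ring.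
  by rewrite EY; ring.
pose T r := I (l * r).
have [I0 ID] := idI.
have idT : ideal T.
  split=> [|a u v Tu Tv]; rewrite /T ?mulr0 //.
  by rewrite mulrDr mulrCA; apply: ID.
have [T0 TD] := idT.
have T12 : T (cX c1 * cX c2).
  rewrite /T mulrC; apply: iprod_mul; last exact: gen2r.
  by apply: iprod_mul; apply: gen2l.
have T13 : T (cX c1 * cX c3).
  rewrite /T mulrCA mulrA; apply: iprod_mul; last exact: gen2l.
  by apply: iprod_mul; [apply: gen2l | apply: gen2r].
have T23 : T (cX c2 * cX c3).
  rewrite /T mulrA; apply: iprod_mul; last exact: gen2l.
  by apply: iprod_mul; [apply: gen2r | apply: gen2l].
have Tll : T (l * l).
  rewrite /T mulrA; apply: iprod_mul; last exact: gen2r.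
  by apply: iprod_mul; apply: gen2r.
have Tp : T (cY + cX m).
  by rewrite /T -EY; do 2?apply: iprod_mul; apply: gen2l.
have T4f : T (4 * cX f).
  have -> : 4 * cX f = 1 * (l * l) + ((3 * cY - cX m) * (cY + cX m) + 0).
    by rewrite -cY2 /l /cline; ring.
  by apply: (TD) => //; apply: (TD).
(* Differentiate c1 c2 c3 = f - m^2. *)
have Tf' : T (cX f^`() + 2 * cX m^`() * cY).
  have -> : cX f^`() + 2 * cX m^`() * cY = 2 * cX m^`() * (cY + cX m) +
     (1 * (cX c1 * cX c2) + (1 * (cX c1 * cX c3) + (1 * (cX c2 * cX c3) + 0))).
    have E' : f^`() = c1 * c2 + c1 * c3 + c2 * c3 + (m * m^`() + m * m^`()).
      rewrite -[f](subrK (m ^+ 2)) -Ec derivD expr2 !derivM !derivXsubC.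
      by rewrite -/c1 -/c2 -/c3; ring.
    by rewrite E' !(cXD, cXM); ring.
  by do 3?[apply: (TD) => //]; apply: (TD).
(* Modulo [T], f' is - 2 m' Y, so its square is 4 m'^2 f, which is already in [T]. *)
have Tf2 : T (cX f^`() * cX f^`()).
  have -> : cX f^`() * cX f^`() = (cX f^`() - 2 * cX m^`() * cY) *
     (cX f^`() + 2 * cX m^`() * cY) + (cX m^`() * cX m^`() * (4 * cX f) + 0).
    by rewrite -cY2; ring.
  by apply: (TD) => //; apply: (TD).
have : T 1 by apply: coord_ideal_full.
by rewrite /T mulr1 => Ic [s ->]; rewrite -[_ * _]addr0; apply: ID.
Qed.

End CoordinateRing.

(** * The group axioms from ideal classes *)

Section GroupLaw.

Variables (F : fieldType) (b : F).
Hypothesis disc_neq0 : 2 * b * (b + 4) != 0.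

Local Notation E := (ec_point b).
Local Notation "p ~~ q" := (ideal_equiv p q) (at level 70).

Definition ec_poly : {poly F} := ('X ^+ 2 + b%:P) * ('X + 2%:P).

Lemma ec_poly_size : size ec_poly = 4.
Proof.
rewrite /ec_poly size_mul ?size_XaddC; last 2 first.
- by rewrite -size_poly_eq0 size_XnaddC.
- by rewrite -size_poly_eq0 size_XaddC.
by rewrite size_XnaddC.
Qed.

Lemma ec_polyE x : ec_poly.[x] = (x ^+ 2 + b) * (x + 2).
Proof. by rewrite /ec_poly !hornerE. Qed.

Lemma disc_factors : [/\ 2 != 0 :> F, b != 0 & b + 4 != 0].
Proof. by move: disc_neq0; rewrite !mulf_eq0 !negb_or => /andP[/andP[]]. Qed.

Lemma ec_poly_sep : exists u v, u * ec_poly + v * ec_poly^`() = 1.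
Proof.
have [n2 n0 n4] := disc_factors.
have Ed : ec_poly^`() = 2 * 'X * ('X + 2%:P) + ('X ^+ 2 + b%:P).
  by rewrite /ec_poly !derivE /= !(mulr0n, mulr0, addr0, mulr1) mulr2n; ring.
pose A : {poly F} := 'X ^+ 2 + b%:P; pose B : {poly F} := 'X + 2.
(* Resultants: A - (X - 2) B = b + 4 and A - X^2 = b. *)
pose q := ('X - 2) ^+ 2 * (3 * A - ('X - 2) * B).
pose r := 'X ^+ 3 - 2 * A * 'X.
pose S := 2 * (A - 3 * ('X - 2) * B) * (A ^+ 2 + 'X * r) + 2 * B ^+ 2 * q.
pose k := 2 * b ^+ 2 * (b + 4) ^+ 3.
have k0 : k != 0 by rewrite !mulf_neq0 // expf_neq0.
(* As f = A B and f' = 2 X B + A, these cofactors give (A^2 S + 2 X B^2 q r) / k. Here A^2 + X r =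
   (A - X^2)^2 = b^2, and A^2 (A - 3 (X - 2) B) + B^2 q = (A - (X - 2) B)^3 = (b + 4)^3, so the
   numerator is k. *)
exists (k^-1%:P * (- 2 * 'X * S - q * r)), (k^-1%:P * (A * S + B * (q * r))).
transitivity (k^-1%:P * k%:P); last by rewrite -polyCM mulVf.
have -> : k%:P = 2 * b%:P ^+ 2 * (b%:P + 4) ^+ 3.
  by rewrite /k !polyCM !polyCD; ring.
rewrite Ed /ec_poly /S /r /q /A /B.
have -> : 2%:P = 2 :> {poly F} by rewrite raddfMn.
by ring.
Qed.

Definition point_class (p : option (F * F)) : coord_ring ec_poly -> Prop :=
  if p is Some (x, y) then point_ideal x y else princ 1.

Lemma ec_slopeP x1 y1 x2 y2 (l := ec_slope b x1 y1 x2 y2) :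
    y1 ^+ 2 = (x1 ^+ 2 + b) * (x1 + 2) -> y2 ^+ 2 = (x2 ^+ 2 + b) * (x2 + 2) ->
    (x1 == x2) && (y1 == - y2) = false ->
  y2 = l * (x2 - x1) + y1 /\
  x2 ^+ 2 + x2 * x1 + x1 ^+ 2 + 2 * (x2 + x1) + b
    - l ^+ 2 * (x2 - x1) - 2 * l * y1 = 0.
Proof.
rewrite /l /ec_slope => E1 E2; case: eqVneq => [E12|Nx] /= Hn.
  have E3 : y1 = y2.
    apply/eqP; rewrite -subr_eq0; move: (subr_sqr y1 y2).
    rewrite E1 E2 E12 subrr => /esym/eqP; rewrite mulf_eq0 => /orP[//|].
    by rewrite (addr_eq0 y1 y2) Hn.
  have N2 : 2 * y1 != 0.
    by rewrite mulr_natl mulr2n {2}E3 (addr_eq0 y1 y2) Hn.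
  rewrite -E12 -E3 subrr mulr0 add0r; split=> //.
  set l' := _ / _.
  have El : l' * (2 * y1) = 3 * x1 ^+ 2 + 4 * x1 + b by rewrite /l' divfK.
  transitivity (3 * x1 ^+ 2 + 4 * x1 + b - l' * (2 * y1)); first by ring.
  by rewrite El subrr.
have N : x2 - x1 != 0 by rewrite subr_eq0 eq_sym.
set l' := _ / _.
have El : y2 = l' * (x2 - x1) + y1 by rewrite /l' divfK // subrK.
split=> //; apply: (mulfI N); rewrite mulr0.
transitivity (((x2 ^+ 2 + b) * (x2 + 2) - (l' * (x2 - x1) + y1) ^+ 2)
  - ((x1 ^+ 2 + b) * (x1 + 2) - y1 ^+ 2)); first by ring.
by rewrite -El -E1 -E2 !subrr.
Qed.

(** The X^2 coefficient of f - m^2 is 2 - l^2, so the roots add up to l^2 - 2, which dictates [x3].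
    The hypotheses say that x1 is a root, and x2 a root of the quotient by X - x1. *)
Lemma ec_line_eq x1 y1 x2 l (x3 := l ^+ 2 - 2 - x1 - x2)
    (m := l%:P * ('X - x1%:P) + y1%:P) :
    y1 ^+ 2 = (x1 ^+ 2 + b) * (x1 + 2) ->
    x2 ^+ 2 + x2 * x1 + x1 ^+ 2 + 2 * (x2 + x1) + b
      - l ^+ 2 * (x2 - x1) - 2 * l * y1 = 0 ->
  ('X - x1%:P) * ('X - x2%:P) * ('X - x3%:P) = ec_poly - m ^+ 2.
Proof.
move=> /(congr1 polyC) E1 /(congr1 polyC) E2.
move: E1 E2; rewrite /x3 /m /ec_poly.
have P2 : 2%:P = 2 :> {poly F} by rewrite raddfMn.
rewrite !(P2, polyCD, polyCN, polyCM, expr2).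
set c1 := x1%:P; set c2 := x2%:P; set d := y1%:P; set e := l%:P.
set B := b%:P => E1 E2.
apply/eqP; rewrite -subr_eq0; apply/eqP.
transitivity ((d * d - (c1 * c1 + B) * (c1 + 2)) - ('X - c1) *
  (c2 * c2 + c2 * c1 + c1 * c1 + 2 * (c2 + c1) + B
      - e * e * (c2 - c1) - 2 * e * d)); first by ring.
by rewrite E1 E2 subrr mulr0 subr0.
Qed.

Lemma polyXsubC_lreg x : GRing.lreg (cX ec_poly ('X - x%:P)).
Proof.
apply: coord_lreg; first exact: ec_poly_size.
by apply/eqP=> -[] /eqP; rewrite polyXsubC_eq0.
Qed.

Lemma point_class_opp (p : E) :
  iprod (point_class (ec_val p)) (point_class (ec_opp_val (ec_val p)))
    ~~ princ 1.
Proof.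
have [n2 _ _] := disc_factors.
case: p => [[[x y]|]] /= Hp; last first.
  by rewrite princ_iprod mulr1; apply: ideal_equiv_refl.
rewrite point_ideal_opp //; [|exact: ec_poly_sep|by rewrite ec_polyE (eqP Hp)].
exact/ideal_equiv_princ/polyXsubC_lreg.
Qed.

(** The points p, q and - (p + q) lie on a line, so their classes multiply to 1; so do the classes
    of p + q and - (p + q). Comparing the two gives the claim. On a vertical line it is
    [point_class_opp]. *)
Lemma point_class_add (p q : E) :
  point_class (ec_add_val b (ec_val p) (ec_val q)) ~~
  iprod (point_class (ec_val p)) (point_class (ec_val q)).
Proof.
have [n2 _ _] := disc_factors.
have := point_class_opp (ec_add p q); have := point_class_opp q; move: p q.
case=> [[[x1 y1]|]] H1 [[[x2 y2]|]] H2 /=; last 3 first.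
- move=> _ _; rewrite iprod_princ1; first exact: ideal_equiv_refl.
  exact: gen2_ideal.
- move=> _ _; rewrite iprodC iprod_princ1; first exact: ideal_equiv_refl.
  exact: gen2_ideal.
- by move=> _ _; rewrite princ_iprod mulr1; apply: ideal_equiv_refl.
move: H1 H2 => /= /eqP H1 /eqP H2.
case: ifP => [/andP[/eqP -> /eqP ->] Q _|Hn _].
  by apply: ideal_equiv_sym; rewrite iprodC.
have [Ey Ex] := ec_slopeP H1 H2 Hn.
set l := ec_slope _ _ _ _ _ in Ey Ex *.
set x3 := l ^+ 2 - 2 - x1 - x2.
pose m := l%:P * ('X - x1%:P) + y1%:P.
have Em : _ * _ * ('X - x3%:P) = ec_poly - m ^+ 2 := ec_line_eq H1 Ex.
rewrite /=; set I1 := point_ideal x1 y1; set I2 := point_ideal x2 y2.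
set I3 := point_ideal x3 _; set I3' := point_ideal x3 _ => H3.
have EI : iprod (iprod I1 I2) I3' = princ (cline ec_poly m).
  apply: point_ideal_line => //; first exact: ec_poly_sep.
  - by rewrite /m !hornerE; ring.
  - by rewrite /m !hornerE -Ey.
  - by rewrite /m !hornerE; ring.
have S : iprod (iprod I1 I2) I3' ~~ princ 1.
  rewrite EI; apply/ideal_equiv_princ/coord_lreg; first exact: ec_poly_size.
  by apply/eqP=> /(congr1 snd) /= /eqP; rewrite subr0 oner_eq0.
have H : iprod (iprod (iprod I1 I2) I3') I3 ~~ iprod (princ 1) I3.
  by apply: ideal_equiv_prod => //; apply: ideal_equiv_refl.
have H' : iprod (iprod I1 I2) (iprod I3 I3') ~~ iprod (iprod I1 I2) (princ 1).
  by apply: ideal_equiv_prod => //; apply: ideal_equiv_refl.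
rewrite iprod_princ1 in H'; last exact/iprod_ideal/gen2_ideal.
rewrite (iprodC (princ 1)) iprod_princ1 in H; last exact: gen2_ideal.
apply: ideal_equiv_trans H'; apply: ideal_equiv_sym.
by rewrite (iprodC I3) iprodA.
Qed.

(** The class of [ec_add p (ec_opp q)] is principal, and among points only infinity has a principal
    class. By its definition [ec_add_val] is [None] only on opposite points, so p = q; associativity
    is derived from this. *)
Lemma point_class_inj (p q : E) :
  point_class (ec_val p) ~~ point_class (ec_val q) -> p = q.
Proof.
move=> H; apply/val_inj => /=.
have H1 : point_class (ec_val (ec_add p (ec_opp q))) ~~ princ 1.
  apply: (ideal_equiv_trans (point_class_add _ _)).
  apply: (ideal_equiv_trans _ (point_class_opp q)).
  by apply: ideal_equiv_prod => //; apply: ideal_equiv_refl.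
have : ec_val (ec_add p (ec_opp q)) = None.
  case: (ec_add _ _) H1 => [[[x y]|]] //= Hp H1; exfalso.
  apply: (point_ideal_nprinc ec_poly_size _ H1).
  by rewrite ec_polyE (eqP Hp).
move: p q {H H1} => [[[x1 y1]|]] H1 [[[x2 y2]|]] H2 //=.
by case: ifP => //; rewrite opprK => /andP[/eqP -> /eqP ->].
Qed.

Lemma ec_addC : commutative (@ec_add F b).
Proof.
move=> p q; apply: point_class_inj.
apply: (ideal_equiv_trans (point_class_add _ _)).
by rewrite iprodC; apply/ideal_equiv_sym/point_class_add.
Qed.

Lemma ec_addA : associative (@ec_add F b).
Proof.
move=> p q r; apply: point_class_inj.
apply: (ideal_equiv_trans (point_class_add _ _)).
apply: ideal_equiv_trans (ideal_equiv_sym (point_class_add _ _)).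
apply: (@ideal_equiv_trans _ _ (iprod (point_class (ec_val p))
   (iprod (point_class (ec_val q)) (point_class (ec_val r))))).
  by apply: ideal_equiv_prod (ideal_equiv_refl _) (point_class_add _ _).
rewrite iprodA; apply: ideal_equiv_sym.
exact: ideal_equiv_prod (point_class_add _ _) (ideal_equiv_refl _).
Qed.

Lemma ec_add0 : left_id (@ec_zero F b) (@ec_add F b).
Proof. by move=> p; apply: val_inj. Qed.

Lemma ec_addN : left_inverse (@ec_zero F b) (@ec_opp F b) (@ec_add F b).
Proof.
move=> [[[x y]|]] H; apply: val_inj => //=.
by rewrite !eqxx.
Qed.

End GroupLaw.

Section ECGroup.

Variables (F : fieldType) (b : F) (nsing : 2 * b * (b + 4) != 0).

(* [ec_point b] is a group only for a nonsingular curve, hence this alias. *)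
Definition ec_group of 2 * b * (b + 4) != 0 : Type := ec_point b.

Local Notation E := (ec_group nsing).

HB.instance Definition _ := [Equality of E by <:].
HB.instance Definition _ := [Choice of E by <:].
HB.instance Definition _ := GRing.isZmodule.Build E
  (ec_addA nsing) (ec_addC nsing) (@ec_add0 F b) (@ec_addN F b).

Lemma ec_addE (p q : E) : p + q = ec_add p q. Proof. by []. Qed.

Lemma ec_zmulE (m : int) (p : E) : ec_zmul m p = p *~ m.
Proof.
have H n : iter n (ec_add p) (ec_zero b) = p *+ n.
  by elim: n => //= n ->; rewrite mulrS.
by case: m => n; rewrite /ec_zmul H.
Qed.

Lemma ec_indepE r (p : 'I_r -> E) : ec_indep p <->
  forall m : 'I_r -> int, \sum_(i < r) p i *~ m i = 0 -> forall i, m i = 0.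
Proof.
have H (m : 'I_r -> int) : \big[@ec_add F b/ec_zero b]_(i < r)
    ec_zmul (m i) (p i) = \sum_(i < r) p i *~ m i.
  by under eq_bigr do rewrite ec_zmulE.
by split=> I m; [rewrite -H | rewrite H]; apply: I.
Qed.

End ECGroup.

(** * Functoriality and ranks *)

Section ECMorphism.

Variables (F F' : fieldType) (phi : {rmorphism F -> F'}) (b : F) (b' : F').
Hypothesis phi_b : phi b = b'.

Definition ec_map_val (p : option (F * F)) : option (F' * F') :=
  if p is Some (x, y) then Some (phi x, phi y) else None.

Lemma ec_map_on_curve (p : ec_point b) : on_curve b' (ec_map_val (ec_val p)).
Proof.
case: p => [[[x y]|]] //= /eqP H; rewrite -phi_b; apply/eqP.
by rewrite -rmorphXn H !(rmorph_nat, rmorphXn, rmorphM, rmorphB, rmorphD).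
Qed.

Definition ec_map (p : ec_point b) : ec_point b' := ECPoint (ec_map_on_curve p).

Lemma ec_mapD p q : ec_map (ec_add p q) = ec_add (ec_map p) (ec_map q).
Proof.
apply: val_inj => /=; move: p q => [[[x1 y1]|]] H1 [[[x2 y2]|]] H2 //=.
rewrite -rmorphN !(inj_eq (fmorph_inj phi)); case: ifP => //= _.
have <- : phi (ec_slope b x1 y1 x2 y2) =
          ec_slope b' (phi x1) (phi y1) (phi x2) (phi y2).
  rewrite /ec_slope (inj_eq (fmorph_inj phi)) -phi_b.
  case: ifP => _; rewrite fmorph_div;
  by rewrite !(rmorph_nat, rmorphXn, rmorphM, rmorphB, rmorphD).
by rewrite !(rmorph_nat, rmorphXn, rmorphM, rmorphB, rmorphD).
Qed.

Lemma ec_map_inj : injective ec_map.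
Proof.
move=> p q /(congr1 (fun r => ec_val r)) /= E; apply: val_inj => /=.
move: p q E => [[[x1 y1]|]] H1 [[[x2 y2]|]] H2 //=.
by case=> /fmorph_inj -> /fmorph_inj ->.
Qed.

Variables (ns : 2 * b * (b + 4) != 0) (ns' : 2 * b' * (b' + 4) != 0).

Definition ec_group_map (p : ec_group ns) : ec_group ns' := ec_map p.

Lemma ec_group_mapB : zmod_morphism ec_group_map.
Proof.
move=> p q; apply/eqP; rewrite eq_sym subr_eq; apply/eqP.
by rewrite ec_addE -ec_mapD -(ec_addE (p - q) q) subrK.
Qed.

HB.instance Definition _ := GRing.isZmodMorphism.Build _ _ ec_group_map
  ec_group_mapB.

End ECMorphism.

Definition extend2 (T : Type) r (x y : T) (p : 'I_r -> T) (i : 'I_r.+2) : T :=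
  if unlift ord0 i is Some j then
    if unlift ord0 j is Some k then p k else y
  else x.

Section RankIncrease.

Variables (A B : zmodType) (f : {additive A -> B}) (tau : {additive B -> B}).
Variable P : B.
Hypothesis f_inj : injective f.
Hypothesis tau_f : forall x, tau (f x) = f x.
Hypothesis tau2P : tau (tau P) = - P.
Hypothesis P_ntors : forall n, P *+ n.+1 <> 0.

Lemma ntors_int (m : int) : P *~ m = 0 -> m = 0.
Proof.
case: m => [[|n]|n] //; first by move/P_ntors.
by rewrite NegzE mulrNz => /eqP; rewrite oppr_eq0 => /eqP /P_ntors.
Qed.

(* tau^2 fixes f A and is -1 on the span of P and tau P; on that span
   (m - n tau)(m + n tau) is multiplication by m^2 + n^2. *)
Lemma indep_extend2 r (p : 'I_r -> A) :
    (forall m : 'I_r -> int, \sum_(i < r) p i *~ m i = 0 -> forall i, m i = 0) ->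
  forall m : 'I_r.+2 -> int,
    \sum_(i < r.+2) extend2 P (tau P) (fun i => f (p i)) i *~ m i = 0 ->
  forall i, m i = 0.
Proof.
move=> indep m; rewrite !big_ord_recl /extend2 unlift_none liftK unlift_none.
under eq_bigr do rewrite !liftK.
set m0 := m _; set m1 := m _; rewrite addrA.
pose m' i := m (lift ord0 (lift ord0 i)).
have -> : \sum_(i < r) f (p i) *~ m (lift ord0 (lift ord0 i)) =
    f (\sum_(i < r) p i *~ m' i).
  by rewrite raddf_sum; apply: eq_bigr => i _; rewrite raddfMz.
set S := P *~ _ + _; set Q := \sum_(i < r) _ => E.
have E' : - S + f Q = 0.
  have := congr1 (fun x => tau (tau x)) E.
  rewrite /= !raddfD /= !raddf0 !tau_f => <-; congr (_ + _).
  by rewrite !raddfMz /= tau2P raddfN !mulNrz.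
have Q2 : Q *~ 2 = 0.
  apply: f_inj; rewrite raddf0 raddfMz.
  have -> : f Q *~ 2 = (S + f Q) + (- S + f Q).
    by rewrite addrACA subrr add0r.
  by rewrite E E' addr0.
have m'0 i : m' i = 0.
  have /indep/(_ i)/eqP : \sum_(i < r) p i *~ (m' i * 2) = 0.
    by under eq_bigr do rewrite mulrzA; rewrite -mulrz_suml.
  by rewrite mulf_eq0 orbF => /eqP.
have S0 : S = 0.
  by move: E; rewrite /Q big1 ?raddf0 ?addr0 // => i _; rewrite m'0.
have S1 : tau P *~ m0 - P *~ m1 = 0.
  have := congr1 tau S0; rewrite raddfD /= !raddfMz raddf0 tau2P => <-.
  by rewrite mulNrz.
have /ntors_int : P *~ (m0 * m0 + m1 * m1) = 0.
  transitivity (S *~ m0 - (tau P *~ m0 - P *~ m1) *~ m1); last first.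
    by rewrite S0 S1 !mul0rz subrr.
  rewrite mulrzDr mulrzBl /S mulrzDl !mulrzA [tau P *~ m1 *~ m0]mulrzAC.
  by rewrite opprB [RHS]addrACA subrr addr0.
move=> m01.
have [m00 m10] : m0 = 0 /\ m1 = 0.
  have H0 (a c : int) : a * a + c * c = 0 -> a = 0.
    move=> ac0; apply/eqP; move: (ac0) => /eqP.
    rewrite paddr_eq0 -?expr2 ?sqr_ge0 // => /andP[].
    by rewrite sqrf_eq0.
  by split; [apply: H0 m01 | apply: H0 (etrans (addrC _ _) m01)].
move=> i; case: (unliftP ord0 i) => [j ->|->] //.
by case: (unliftP ord0 j) => [k ->|->] //; apply: m'0.
Qed.

End RankIncrease.

(** If the rank over [F'] is [+oo] the bound is trivial. Otherwise it bounds the independent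
    families over [F], so the maximum that defines [ec_rank b] exists. *)
Lemma ec_rank_lt2 (F F' : fieldType) (b : F) (b' : F') :
    (forall r (p : 'I_r -> ec_point b), ec_indep p ->
       exists p' : 'I_r.+2 -> ec_point b', ec_indep p') ->
  (ec_rank b + (Posz 2)%:E <= ec_rank b')%E.
Proof.
move=> H; rewrite /(ec_rank b'); case: pselect => [h|_]; last exact: leey.
case: (cid h) => r' /= [_ max'].
have bnd s (p : 'I_s -> ec_point b) : ec_indep p -> (s.+2 <= r')%N.
  by move=> /H[p' /max'].
rewrite /ec_rank; case: pselect => [h'|nh]; last first.
  case: nh; pose Pr s := `[< exists p : 'I_s -> ec_point b, ec_indep p >].
  have ex0 : exists s, Pr s.
    exists 0%N; apply/asboolP.
    by exists (fun _ => ec_zero b) => m _ [].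
  have ub s : Pr s -> (s <= r')%N.
    by move=> /asboolP[p /bnd /ltnW /ltnW].
  case: (ex_maxnP ex0 ub) => s /asboolP Ps maxs; exists s; split=> // t p Ip.
  by apply: maxs; apply/asboolP; exists p.
case: (cid h') => r /= [[p Ip] _].
by rewrite -EFinD lee_fin -PoszD lez_nat addn2; apply: bnd Ip.
Qed.

(** * 2-adic integrality and points of infinite order *)

(* An abstraction of the ring of 2-integral elements of a field. *)
Record dyadic_ring (F : fieldType) (O : F -> Prop) : Prop := DyadicRing {
  dyadic1 : O 1;
  dyadicB : forall x y, O x -> O y -> O (x - y);
  dyadicM : forall x y, O x -> O y -> O (x * y);
  dyadicV : forall x, O x -> 1 + 2 * x != 0 /\ O (1 + 2 * x)^-1;
  dyadic_half : ~ O 2^-1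
}.

Section DyadicRing.

Variables (F : fieldType) (O : F -> Prop) (dyO : dyadic_ring O).

Lemma dyadic0 : O 0.
Proof. by rewrite -(subrr 1); apply: dyadicB; rewrite //; apply: dyadic1. Qed.

Lemma dyadicN x : O x -> O (- x).
Proof. by move=> Ox; rewrite -sub0r; apply: dyadicB => //; apply: dyadic0. Qed.

Lemma dyadicD x y : O x -> O y -> O (x + y).
Proof.
by move=> Ox Oy; rewrite -[y]opprK; apply: dyadicB => //; apply: dyadicN.
Qed.

Lemma dyadic_nat n : O n%:R.
Proof.
elim: n => [|n IH]; first exact: dyadic0.
by rewrite -natr1; apply: dyadicD => //; apply: dyadic1.
Qed.

Lemma dyadicX x n : O x -> O (x ^+ n).
Proof.
move=> Ox; elim: n => [|n IH]; first exact: dyadic1.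
by rewrite exprS; apply: dyadicM.
Qed.

Lemma dyadic_two_neq0 : 2 != 0 :> F.
Proof.
apply/eqP=> E; apply: (dyadic_half dyO).
by rewrite E invr0; apply: dyadic0.
Qed.

Lemma dyadic_four_nunit n a : O a -> 4 ^+ n.+1 * a <> 1.
Proof.
move=> Oa E; apply: (dyadic_half dyO).
have n2 := dyadic_two_neq0.
suff -> : 2^-1 = 2 * 4 ^+ n * a.
  apply: (dyadicM dyO) => //; apply: (dyadicM dyO); first exact: dyadic_nat.
  by apply: dyadicX; apply: dyadic_nat.
apply: (mulfI n2); rewrite divff //.
by transitivity (4 ^+ n.+1 * a); [rewrite E | rewrite exprS; ring].
Qed.

Local Ltac dyadic_tac := do ?[assumption | apply: dyadic1 |
  apply: dyadic_nat | apply: dyadicX | apply: dyadicN |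
  apply: (dyadicM dyO) | apply: dyadicD].

Section Doubling.

Variables (b : F) (ns : 2 * b * (b + 4) != 0).
Local Notation E := (ec_group ns).

(* With u = 1/x, the duplication formula reads
   u(2 p) = 4 u (1 + 2u + b u^2 + 2b u^3)
              / (1 - 2b u^2 - 16b u^3 + (b^2 - 16b) u^4). *)
Lemma ec_double_dyadic (p : E) x y c :
    ec_val p = Some (x, y) -> x != 0 -> O x^-1 -> O c ->
    b * (x^-1) ^+ 2 = 2 * c ->
  exists x' y' e, [/\ ec_val (p + p) = Some (x', y'), x' != 0,
    x'^-1 = 4 * e * x^-1, e != 0 & O e /\ O e^-1].
Proof.
move=> Ep x0; set u := x^-1 => Ou Oc bu.
have n2 := dyadic_two_neq0.
have /eqP H : on_curve b (Some (x, y)) by rewrite -Ep; case: (p).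
have ux : x * u = 1 by rewrite /u divff.
have u0 : u != 0 by rewrite invr_eq0.
(* [N] and [D] are the two cubic and quartic factors of the duplication formula, rewritten with b
   u^2 = 2 c; both are visibly in 1 + 2 O. Here b itself may lie outside [O]. *)
pose N := 1 + 2 * (u + c + 2 * c * u).
pose D := 1 + 2 * (- (2 * c) - 16 * c * u + 2 * c ^+ 2 - 16 * c * u ^+ 2).
have [N0 ON'] : N != 0 /\ O N^-1.
  apply: (dyadicV dyO).
  by dyadic_tac.
have [D0 OD'] : D != 0 /\ O D^-1.
  apply: (dyadicV dyO).
  by dyadic_tac.
have ON : O N.
  by dyadic_tac.
have OD : O D.
  by dyadic_tac.
have bE : b = 2 * c * x ^+ 2.
  by rewrite -bu -mulrA -exprMn [u * x]mulrC ux expr1n mulr1.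
have yE : y ^+ 2 = x ^+ 3 * N.
  by rewrite H bE /N /u; field.
have dE : (3 * x ^+ 2 + 4 * x + b) ^+ 2 =
    x ^+ 4 * D + 8 * (1 + x) * (x ^+ 3 * N).
  by rewrite bE /D /N /u; field.
have y0 : y != 0.
  by rewrite -sqrf_eq0 yE mulf_neq0 // expf_neq0.
have y2 : (y == - y) = false.
  by apply/negbTE; rewrite -addr_eq0 -mulr2n -mulr_natl mulf_neq0.
have n4 : 4 != 0 :> F by rewrite (natrM _ 2 2) mulf_neq0.
rewrite ec_addE /= Ep /= eqxx y2 /=; set x' := _ - x - x; set y' := _ - y.
have x'E : x' = x * D / (4 * N).
  rewrite /x' /ec_slope eqxx exprMn dE exprVn exprMn yE.
  by field; rewrite N0 n4.
exists x', y', (N / D); rewrite x'E; split=> //.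
- by rewrite !mulf_neq0 ?invr_eq0 ?mulf_neq0.
- by rewrite /u; field; rewrite ?x0 ?N0 ?D0 ?n4.
- by rewrite mulf_neq0 ?invr_eq0.
- by rewrite invf_div; split; apply: (dyadicM dyO).
Qed.

(** Each doubling multiplies 1/x by 4 times a unit and [c] by the square of that factor, so the
    hypotheses persist. A coincidence between two of the iterated doubles would make a positive
    power of 4 a unit of [O]. *)
Lemma ec_dyadic_ntors (p : E) x y c :
    ec_val p = Some (x, y) -> x != 0 -> O x^-1 -> O c ->
    b * (x^-1) ^+ 2 = 2 * c ->
  forall n, p *+ n.+1 <> 0.
Proof.
move=> Ep x0 Ou Oc bu.
have step k : exists x' y' e, [/\ ec_val (p *+ (2 ^ k)) = Some (x', y'),
    x' != 0, x'^-1 = 4 ^+ k * e * x^-1, e != 0 & O e /\ O e^-1].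
  elim: k => [|k [x' [y' [e [E' x'0 xE e0 [Oe Oe']]]]]].
    exists x, y, 1; rewrite expn0 mulr1n expr0 !mul1r invr1 oner_eq0.
    by split=> //; split; apply: dyadic1.
  have [|||x2 [y2 [e2 [E2 x20 xE2 e20 [Oe2 Oe2']]]]] :=
      @ec_double_dyadic _ x' y' (c * (4 ^+ k * e) ^+ 2) E' x'0.
  - rewrite xE; do 2?[apply: (dyadicM dyO)] => //.
    by apply: dyadicX; apply: dyadic_nat.
  - apply: (dyadicM dyO) => //; apply: dyadicX; apply: (dyadicM dyO) => //.
    by apply: dyadicX; apply: dyadic_nat.
  - by rewrite xE exprMn mulrCA bu; ring.
  exists x2, y2, (e2 * e); split=> //.
  - by rewrite expnS mulnC mulrnA mulr2n.
  - by rewrite xE2 xE exprS; ring.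
  - by rewrite mulf_neq0.
  - by rewrite invfM; split; apply: (dyadicM dyO).
have inj j k : p *+ (2 ^ j) <> p *+ (2 ^ (j + k.+1)).
  move=> Ejk; have [x1 [y1 [e1 [E1 x10 xE1 e10 [Oe1 Oe1']]]]] := step j.
  have [x2 [y2 [e2 [E2 x20 xE2 e20 [Oe2 Oe2']]]]] := step (j + k.+1)%N.
  have n4 : 4 != 0 :> F by rewrite (natrM _ 2 2) mulf_neq0 ?dyadic_two_neq0.
  move: E2; rewrite -Ejk E1 => -[Ex _]; move: xE2; rewrite -Ex xE1 => Ee.
  apply: (@dyadic_four_nunit k (e2 / e1)); first exact: (dyadicM dyO).
  have u0 : x^-1 != 0 by rewrite invr_eq0.
  move/(mulIf u0): Ee; rewrite exprD -mulrA.
  move/(mulfI (expf_neq0 j n4)) => Ee.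
  by rewrite mulrA -Ee divff.
move=> n En.
(* Pigeonhole on the powers of 2 modulo n + 1: for a point killed by n + 1, two of the iterated
   doubles coincide. *)
have [j [k Ejk]] : exists j k, 2 ^ j = 2 ^ (j + k.+1) %[mod n.+1].
  pose g (i : 'I_n.+2) : 'I_n.+1 := inord (2 ^ i %% n.+1).
  have /injectivePn[i [j ij Eg]] : ~~ injectiveb g.
    apply/negP=> /injectiveP /leq_card; rewrite !card_ord.
    by rewrite ltnn.
  have Em : 2 ^ i = 2 ^ j %[mod n.+1].
    by have := congr1 val Eg; rewrite /= !inordK ?ltn_pmod.
  move: ij; rewrite -val_eqE neq_ltn => /orP[] lt.
    by exists i, (j - i).-1; rewrite prednK ?subn_gt0 // subnKC // ltnW.
  by exists j, (i - j).-1; rewrite prednK ?subn_gt0 // subnKC // ltnW.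
apply: (inj j k); rewrite (divn_eq (2 ^ j) n.+1) [in RHS](divn_eq (2 ^ _) n.+1).
by rewrite Ejk !mulrnDr ![(_ * n.+1)%N]mulnC !mulrnA En !mul0rn.
Qed.

End Doubling.

(** The inverse of 1 + 2 (x + y s) is its conjugate divided by its norm (1 + 2 x)^2 - 4 n y^2, which
    is again in 1 + 2 O. Since s is outside F, coordinates on 1 and s are unique, and this keeps 1/2
    out. *)
Lemma dyadic_quadratic (L : fieldType) (phi : {rmorphism F -> L}) (s : L) n :
    s ^+ 2 = n%:R -> (forall x, phi x != s) ->
  dyadic_ring (fun z => exists x y, [/\ O x, O y & z = phi x + phi y * s]).
Proof.
move=> s2 sN.
have indep x y : phi x + phi y * s = 0 -> x = 0 /\ y = 0.
  move=> E; have [y0|y0] := eqVneq y 0.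
    move: E; rewrite y0 rmorph0 mul0r addr0 => /eqP.
    by rewrite fmorph_eq0 => /eqP.
  case/negP: (sN (- x / y)); rewrite fmorph_div rmorphN; apply/eqP.
  apply: (mulIf (_ : phi y != 0)); first by rewrite fmorph_eq0.
  by rewrite divfK ?fmorph_eq0 // mulrC; apply/eqP; rewrite eq_sym -addr_eq0 addrC E.
split.
- exists 1, 0; rewrite rmorph1 rmorph0 mul0r addr0.
  by split=> //; [apply: dyadic1 | apply: dyadic0].
- move=> _ _ [x [y [Ox Oy ->]]] [x' [y' [Ox' Oy' ->]]].
  exists (x - x'), (y - y'); split; try exact: dyadicB.
  by rewrite !rmorphB; ring.
- move=> _ _ [x [y [Ox Oy ->]]] [x' [y' [Ox' Oy' ->]]].
  exists (x * x' + y * y' * n%:R), (x * y' + y * x'); split.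
  + by apply: dyadicD; do !apply: (dyadicM dyO) => //; apply: dyadic_nat.
  + by apply: dyadicD; apply: (dyadicM dyO).
  + rewrite !rmorphD !rmorphM rmorph_nat -s2; ring.
- move=> _ [x [y [Ox Oy ->]]].
  pose d := 1 + 2 * (2 * x + 2 * x ^+ 2 - 2 * y ^+ 2 * n%:R).
  have [d0 Od] : d != 0 /\ O d^-1.
    apply: (dyadicV dyO).
    by dyadic_tac.
  set z := 1 + _; set z' := phi (1 + 2 * x) - phi (2 * y) * s.
  have zz : z * z' = phi d.
    rewrite /z /z' /d !(rmorph_nat, rmorphXn, rmorphM, rmorphB, rmorphD).
    by rewrite rmorph1 -s2; ring.
  have z0 : z != 0.
    by apply: contra_neq d0 => z0; apply/eqP; rewrite -(fmorph_eq0 phi) -zz z0 mul0r.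
  split=> //; exists ((1 + 2 * x) / d), (- (2 * y) / d); split.
  + apply: (dyadicM dyO) => //; apply: dyadicD; first exact: dyadic1.
    by apply: (dyadicM dyO) => //; apply: dyadic_nat.
  + apply: (dyadicM dyO) => //; apply: dyadicN.
    by apply: (dyadicM dyO) => //; apply: dyadic_nat.
  + apply: (mulfI z0); rewrite divff // !fmorph_div rmorphN.
    transitivity (z * z' / phi d); first by rewrite zz divff // fmorph_eq0.
    by rewrite /z'; ring.
- move=> [x [y [Ox Oy E]]].
  have [|x0 _] := indep (x - 2^-1) y.
    by rewrite rmorphB addrAC -E fmorphV rmorph_nat subrr.
  move/eqP: x0; rewrite subr_eq0 => /eqP Ex.
  by apply: (dyadic_half dyO); rewrite -Ex.
Qed.

End DyadicRing.

Definition odd_denom (q : rat) : Prop :=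
  exists (a d : int), odd `|d| /\ q * d%:~R = a%:~R.

Lemma odd_denom_dyadic : dyadic_ring odd_denom.
Proof.
split.
- by exists 1, 1.
- move=> x y [a [d [od E]]] [a' [d' [od' E']]].
  exists (a * d' - a' * d), (d * d'); split; first by rewrite abszM oddM od.
  by rewrite rmorphM rmorphB !rmorphM /= -E -E'; ring.
- move=> x y [a [d [od E]]] [a' [d' [od' E']]].
  exists (a * a'), (d * d'); split; first by rewrite abszM oddM od.
  by rewrite !rmorphM /= -E -E'; ring.
- move=> x [a [d [od E]]].
  have d0 : d%:~R != 0 :> rat by rewrite intr_eq0; apply: contraL od => /eqP ->.
  have odd' : odd (absz (d + 2 * a)) by lia.
  have E' : (1 + 2 * x) * d%:~R = (d + 2 * a)%:~R.
    by rewrite rmorphD rmorphM /= -E; ring.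
  have x0 : 1 + 2 * x != 0.
    apply: contraL odd' => /eqP x0; move: E'; rewrite x0 mul0r => /esym/eqP.
    by rewrite intr_eq0 => /eqP ->.
  by split=> //; exists d, (d + 2 * a); split=> //; rewrite -E' mulKf.
- move=> [a [d [od E]]].
  have : d%:~R = (2 * a)%:~R :> rat by rewrite rmorphM /= -E mulVKf.
  by move/intr_inj => Ed; move: od; rewrite Ed; lia.
Qed.

Lemma odd_denom_scale (q : rat) : exists k, odd_denom (q *+ 2 ^ k).
Proof.
pose n := `|denq q|%N; have n0 : (0 < n)%N by rewrite absz_gt0 denq_neq0.
have [m co Em] := pfactor_coprime (isT : prime 2) n0.
exists (logn 2 n), (numq q), m%:Z; split.
  by rewrite /= -coprime2n.
rewrite -mulr_natr -mulrA -[_%:~R]/(m%:R) -natrM mulnC -Em.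
have -> : n%:R = (denq q)%:~R :> rat by rewrite -[denq q]absz_denq.
by rewrite -{1}[q]divq_num_den divfK // intr_eq0 denq_neq0.
Qed.

(** * Determinants of matrices congruent to the identity modulo 2 *)

Section MatrixDyadic.

Variables (F : fieldType) (O : F -> Prop) (dyO : dyadic_ring O) (n : nat).

Lemma dyadic_sum (I : finType) (f : I -> F) :
  (forall i, O (f i)) -> O (\sum_i f i).
Proof. by move=> H; apply: big_ind => //; [apply: dyadic0|apply: dyadicD]. Qed.

Lemma dyadic_prod (I : finType) (f : I -> F) :
  (forall i, O (f i)) -> O (\prod_i f i).
Proof. by move=> H; apply: big_ind => //; [apply: dyadic1|apply: dyadicM]. Qed.

Lemma dyadic_det m (A : 'M[F]_m) : (forall i j, O (A i j)) -> O (\det A).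
Proof.
move=> H; apply: dyadic_sum => s; apply: (dyadicM dyO).
  by apply: dyadicX => //; apply: dyadicN => //; apply: dyadic1.
exact: dyadic_prod.
Qed.

Lemma dyadic_adj (A : 'M[F]_n) :
  (forall i j, O (A i j)) -> forall i j, O (\adj A i j).
Proof.
move=> H i j; rewrite mxE; apply: (dyadicM dyO).
  by apply: dyadicX => //; apply: dyadicN => //; apply: dyadic1.
by apply: dyadic_det => k l; rewrite !mxE.
Qed.

(* Only the identity permutation contributes modulo 2. *)
Lemma dyadic_det1D (A : 'M[F]_n) : (forall i j, O (A i j)) ->
  exists2 x, O x & \det (1%:M + 2 *: A) = 1 + 2 * x.
Proof.
move=> H.
have Hd : exists2 x, O x & \prod_i (1%:M + 2 *: A) i i = 1 + 2 * x.
  apply: (big_ind (fun z => exists2 x, O x & z = 1 + 2 * x)).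
  - by exists 0; [apply: dyadic0 | rewrite mulr0 addr0].
  - move=> _ _ [x Ox ->] [y Oy ->]; exists (x + y + 2 * (x * y)); last by ring.
    by do ![apply: dyadicD => //]; do ![apply: (dyadicM dyO) => //];
       apply: dyadic_nat.
  - by move=> i _; exists (A i i) => //; rewrite !mxE eqxx.
have Hs : exists2 x, O x & \sum_(s : 'S_n | s != 1%g)
    (-1) ^+ s * \prod_i (1%:M + 2 *: A) i (s i) = 2 * x.
  apply: (big_ind (fun z => exists2 x, O x & z = 2 * x)).
  - by exists 0; [apply: dyadic0 | rewrite mulr0].
  - move=> _ _ [x Ox ->] [y Oy ->]; exists (x + y); last by ring.
    exact: dyadicD.
  - move=> s s1; have [i si] : exists i, s i != i.
      apply/existsP; apply: contraR s1; rewrite negb_exists => /forallP Hs.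
      by apply/eqP/permP=> i; rewrite perm1; apply/eqP; rewrite -[_ == _]negbK.
    exists ((-1) ^+ s * (A i (s i) *
       \prod_(j | j != i) (1%:M + 2 *: A) j (s j))); last first.
      have Ei : (1%:M + 2 *: A) i (s i) = 2 * A i (s i).
        by rewrite !mxE eq_sym (negbTE si) add0r.
      by rewrite (bigD1 i) //= Ei; move: ((-1) ^+ s) => z; ring.
    apply: (dyadicM dyO).
      by apply: dyadicX => //; apply: dyadicN => //; apply: dyadic1.
    apply: (dyadicM dyO) => //; apply: big_ind; first exact: dyadic1.
      exact: dyadicM.
    move=> j _; rewrite !mxE; apply: dyadicD => //; first exact: dyadic_nat.
    by apply: (dyadicM dyO) => //; apply: dyadic_nat.
have [x Ox Ex] := Hd; have [y Oy Ey] := Hs.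
exists (x + y); first exact: dyadicD.
rewrite /determinant (bigD1 1%g) //= Ey odd_perm1 expr0 mul1r.
by under eq_bigr do rewrite perm1; rewrite Ex; ring.
Qed.

End MatrixDyadic.

(** * 2-integral elements of a number field *)

Section NumberField.

Variable K : fieldExtType rat.

Local Notation n := (\dim {:K}).
Local Notation e := (vbasis {:K}).

Definition mult_mx (a : K) : 'M[rat]_n := \matrix_(i, j) coord e j (e`_i * a).

Lemma mult_mxE a (i : 'I_n) : e`_i * a = \sum_(j < n) mult_mx a i j *: e`_j.
Proof.
rewrite {1}[_ * a](coord_vbasis (memvf _)).
by apply: eq_bigr => j _; rewrite mxE.
Qed.

Lemma mult_mxM a c : mult_mx (a * c) = mult_mx a *m mult_mx c.
Proof.
apply/matrixP=> i j; rewrite !mxE mulrA mult_mxE mulr_suml linear_sum.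
by apply: eq_bigr => k _; rewrite -scalerAl linearZ /= [mult_mx c k j]mxE.
Qed.

Lemma mult_mxD a c : mult_mx (a + c) = mult_mx a + mult_mx c.
Proof. by apply/matrixP=> i j; rewrite !mxE mulrDr raddfD. Qed.

Lemma mult_mxB a c : mult_mx (a - c) = mult_mx a - mult_mx c.
Proof. by apply/matrixP=> i j; rewrite !mxE mulrBr raddfB. Qed.

Lemma mult_mxZ q a : mult_mx (q *: a) = q *: mult_mx a.
Proof. by apply/matrixP=> i j; rewrite !mxE -scalerAr linearZ. Qed.

Lemma mult_mx1 : mult_mx 1 = 1%:M.
Proof.
apply/matrixP=> i j; rewrite !mxE mulr1 coord_free 1?eq_sym //.
exact: basis_free (vbasisP _).
Qed.

(** The stabilizer of the lattice spanned by the basis over the rationals with odd denominator. It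
    is an order, possibly not maximal, and involves no choice of a prime above 2. *)
Definition dyadic_int (a : K) := forall i j, odd_denom (mult_mx a i j).

(** If x acts by an integral matrix A, then 1 + 2 x acts by 1 + 2 A, whose determinant has the form
    1 + 2 d; by Cramer's rule the inverse is integral. The element 1/2 acts by a scalar matrix with
    entry 1/2. *)
Lemma dyadic_int_ring : dyadic_ring dyadic_int.
Proof.
have dyQ := odd_denom_dyadic.
have n_gt0 : (0 < n)%N by exact: adim_gt0.
split.
- by move=> i j; rewrite mult_mx1 mxE; apply: dyadic_nat.
- move=> x y Hx Hy i j.
  by have := dyadicB dyQ (Hx i j) (Hy i j); rewrite mult_mxB !mxE.
- move=> x y Hx Hy i j; rewrite mult_mxM mxE.
  by apply: (dyadic_sum dyQ) => k; apply: (dyadicM dyQ); [apply: Hx | apply: Hy].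
- move=> x Hx; have [d Od Ed] := dyadic_det1D dyQ Hx.
  have [d0 Od'] := dyadicV dyQ Od.
  have E1 : mult_mx (1 + 2 * x) = 1%:M + 2 *: mult_mx x.
    by rewrite mult_mxD mult_mx1 -mult_mxZ scaler_nat mulr_natl.
  have x0 : 1 + 2 * x != 0.
    apply: contra_neq d0 => x0; rewrite -Ed -E1 x0.
    have -> : mult_mx 0 = 0 by rewrite -(subrr 1) mult_mxB subrr.
    (* The empty zero matrix has determinant 1, hence the use of [n_gt0]. *)
    by move: n_gt0; case: n => // k _; apply: det0.
  split=> // i j.
  have -> : mult_mx (1 + 2 * x)^-1 = (1 + 2 * d)^-1 *: \adj (1%:M + 2 *: mult_mx x).
    apply: (scalerI d0); rewrite scalerA divff // scale1r -Ed.
    rewrite -mul_mx_scalar -mul_mx_adj -E1 mulmxA -mult_mxM mulVf // mult_mx1.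
    by rewrite mul1mx.
  rewrite mxE; apply: (dyadicM dyQ) => //; apply: (dyadic_adj dyQ) => k l.
  have := Hx k l; rewrite !mxE => Hkl.
  apply: (dyadicD dyQ); first exact: dyadic_nat.
  by apply: (dyadicM dyQ) => //; apply: dyadic_nat.
- move=> H; apply: (dyadic_half dyQ).
  have := H (Ordinal n_gt0) (Ordinal n_gt0).
  have -> : 2^-1 = (2^-1 : rat) *: (1 : K).
    have n2 : 2 != 0 :> K by rewrite -(rmorph_nat (in_alg K)) fmorph_eq0.
    apply: (mulfI n2); rewrite divff // -scalerAr mulr1.
    by rewrite -[X in _ *: X](scaler_nat 2 1) scalerA mulVf ?scale1r.
  by rewrite mult_mxZ mult_mx1 !mxE eqxx mulr1.
Qed.

Lemma dyadic_int_scale (a : K) : exists k, dyadic_int (2 ^+ k * a).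
Proof.
have dyQ := odd_denom_dyadic.
have [k Hk] := fin_all_exists
  (fun ij : 'I_n * 'I_n => odd_denom_scale (mult_mx a ij.1 ij.2)).
exists (\sum_ij k ij)%N => i j.
have -> : 2 ^+ (\sum_ij k ij) * a = (2 ^ (\sum_ij k ij))%:R *: a.
  by rewrite scaler_nat -natrX mulr_natl.
rewrite mult_mxZ mxE (bigD1 (i, j)) //= expnD natrM mulrAC mulr_natl.
by apply: (dyadicM dyQ); [apply: (Hk (i, j)) | apply: dyadic_nat].
Qed.

End NumberField.

(** * Primes that are not squares in a number field *)

(** The p-adic valuation is 1 on the left and even on a nonzero square. *)
Lemma prime_mul_nsquare p m (r : rat) : prime p -> ~~ (p %| m)%N ->
  p%:R * m%:R <> r ^+ 2.
Proof.
move=> pp pm E.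
have m0 : (0 < m)%N by case: m pm {E}; rewrite // dvdn0.
have p0 := prime_gt0 pp.
pose a := `|numq r|%N; pose d := `|denq r|%N.
have d0 : (0 < d)%N by rewrite absz_gt0 denq_neq0.
have EN : (p * m * d ^ 2 = a ^ 2)%N.
  apply/eqP; rewrite -(eqr_nat rat) natrM natrM !natrX E -exprMn.
  have -> : d%:R = (denq r)%:~R :> rat by rewrite -[denq r]absz_denq.
  have -> : a%:R ^+ 2 = (numq r)%:~R ^+ 2 :> rat.
    by rewrite /a natr_absz intr_norm real_normK ?num_real.
  by rewrite -{1}[r]divq_num_den divfK // intr_eq0 denq_neq0.
have := congr1 (logn p) EN; rewrite lognM ?muln_gt0 ?p0 ?m0 ?expn_gt0 ?d0 //.
rewrite lognM // !lognX logn_prime // eqxx (lognE p m) (negbTE pm) !andbF.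
lia.
Qed.

Section QuadraticAdjoin.

Variables (F0 : fieldType) (N : fieldExtType F0) (F : {subfield N}) (s : N).
Hypothesis s2F : s ^+ 2 \in F.

Lemma Fadjoin_sqrt t : t \in <<F; s>>%VS ->
  exists x y, [/\ x \in F, y \in F & t = x + y * s].
Proof.
case/Fadjoin_polyP=> q /polyOverP qF ->; rewrite horner_coef.
apply: (big_ind (fun z => exists x y, [/\ x \in F, y \in F & z = x + y * s])).
- by exists 0, 0; rewrite !rpred0 mul0r addr0.
- move=> _ _ [x [y [xF yF ->]]] [x' [y' [xF' yF' ->]]].
  by exists (x + x'), (y + y'); split; rewrite ?rpredD //; ring.
- move=> i _; rewrite -[in s ^+ _](odd_double_half i) exprD -mul2n exprM.
  have cF : q`_i * (s ^+ 2) ^+ i./2 \in F.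
    by apply: rpredM; [apply: qF | apply: rpredX].
  case: (odd i).
    by exists 0, (q`_i * (s ^+ 2) ^+ i./2); split; rewrite ?rpred0 //; ring.
  by exists (q`_i * (s ^+ 2) ^+ i./2), 0; split; rewrite ?rpred0 //; ring.
Qed.

End QuadraticAdjoin.

(* If every prime were a square in N, then adjoining square roots of larger and
   larger primes would produce subfields of N of unbounded degree. *)
Lemma exists_prime_nsquare (N : fieldExtType rat) :
  exists2 p, prime p & forall s : N, s ^+ 2 != p%:R.
Proof.
apply: contrapT => H.
have {}H p : prime p -> exists s : N, s ^+ 2 = p%:R.
  move=> pp; apply: contrapT => Hs; apply: H; exists p => // s.
  by apply/eqP=> Es; apply: Hs; exists s.
(* Up to rational squares, every rational number that is a square in F is a product of primes at
   most B. Hence a prime above B is not a square in F, and adjoining its root enlarges F. *)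
pose sqbound (F : {subfield N}) B := forall t (c : rat), t \in F ->
  t ^+ 2 = c%:A -> exists m (r : rat), [/\ (0 < m)%N,
    forall q, prime q -> (q %| m)%N -> (q <= B)%N & c * m%:R = r ^+ 2].
suff /(_ (\dim {:N})) [F [B [lt _]]] : forall k, exists (F : {subfield N}) B,
    (k < \dim F)%N /\ sqbound F B.
  by move: lt; rewrite ltnNge dimvS ?subvf.
elim=> [|k [F [B [lt sqF]]]].
  exists 1%AS, 0%N; split; first by rewrite adim_gt0.
  move=> t c /vlineP[r ->]; rewrite exprZn expr1n => /(fmorph_inj (in_alg N)) <-.
  exists 1%N, r; split=> //; last by rewrite mulr1.
  by move=> q qp; rewrite dvdn1 => /eqP q1; rewrite q1 in qp.
have [p Bp pp] := prime_above B; have [s Es] := H p pp.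
have n2 : 2 != 0 :> N by rewrite -(rmorph_nat (in_alg N)) fmorph_eq0.
have s2F : s ^+ 2 \in F by rewrite Es rpred_nat.
have sNF : s \notin F.
  apply/negP=> sF; have [|m [r [m0 mB E]]] := sqF s p%:R sF.
    by rewrite Es scaler_nat.
  apply: (@prime_mul_nsquare p m r) => //; apply/negP=> /(mB p pp).
  by rewrite leqNgt Bp.
exists <<F; s>>%AS, p; split.
  apply: leq_ltn_trans lt _; rewrite ltnNge; apply: contra sNF => le.
  have /eqP -> : F == <<F; s>>%AS :> {vspace N} by rewrite eqEdim subv_adjoin.
  exact: memv_adjoin.
move=> t c /(Fadjoin_sqrt s2F)[x [y [xF yF Et]]] E.
(* Otherwise t^2 = x^2 + y^2 s^2 + 2 x y s could be solved for s in F. *)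
have xy0 : x * y = 0.
  apply/eqP; apply: contraNT sNF => xy0.
  have -> : s = (t ^+ 2 - x ^+ 2 - y ^+ 2 * s ^+ 2) / (2 * (x * y)).
    have xy2 : 2 * (x * y) != 0 by rewrite mulf_neq0.
    by apply: (mulIf xy2); rewrite [RHS]divfK // Et; ring.
  apply: rpred_div; last by apply: rpredM; [apply: rpred_nat | apply: rpredM].
  apply: rpredB; last by apply: rpredM; first apply: rpredX.
  apply: rpredB; last exact: rpredX.
  by rewrite E rpredZ ?rpred1.
move/eqP: xy0; rewrite mulf_eq0 => /orP[] /eqP z0.
  (* Here t = y s, so t s lies in F and has square c p; the extra prime p goes into the multiplier
     m. *)
  have [||m [r [m0 mB Er]]] := sqF (t * s) (c * p%:R).
  - by rewrite Et z0 add0r -mulrA -expr2 rpredM.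
  - by rewrite exprMn E Es -scalerAl mul1r -scalerA scaler_nat.
  exists (p * m)%N, r; split; first by rewrite muln_gt0 prime_gt0.
  - move=> q qp; rewrite Euclid_dvdM // => /orP[|/(mB q qp) le].
      by rewrite dvdn_prime2 // => /eqP ->.
    by rewrite (leq_trans le) // ltnW.
  - by rewrite natrM mulrA.
have tF : t \in F by rewrite Et z0 mul0r addr0.
have [m [r [m0 mB Er]]] := sqF t c tF E.
exists m, r; split=> // q qp /(mB q qp) le.
by rewrite (leq_trans le) // ltnW.
Qed.

(** * Cyclic quartic extensions *)

Lemma simple_extension (F Omega : fieldType) (j : {rmorphism F -> Omega})
    (p : {poly F}) (zeta : Omega) :
    p != 0 -> root (map_poly j p) zeta ->
    (forall q, root (map_poly j q) zeta -> q != 0 -> (size p <= size q)%N) ->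
  exists (L : fieldExtType F) (z : L) (iota : {rmorphism L -> Omega}),
    [/\ forall a, iota a%:A = j a, iota z = zeta,
        forall x, exists q, x = (map_poly (in_alg L) q).[z] &
        \dim {:L} = (size p).-1].
Proof.
move=> p0 pz /(subfx_irreducibleP pz p0) irr.
exists (SubFieldExtType pz irr), (subfx_root j zeta p).
exists (@subfx_inj F Omega j zeta p : {rmorphism _ -> _}); split.
- exact: subfx_inj_base.
- exact: subfx_inj_root.
- by move=> x; have [q Eq] := subfxEroot pz p0 x; exists q.
- by rewrite dimvf.
Qed.

Section QuarticIndependence.

Variables (F Omega : fieldType) (j : {rmorphism F -> Omega}).
Variables (im v g : F) (zeta : Omega).
Hypothesis im2 : im ^+ 2 = -1.
Hypothesis g0 : g != 0.
Hypothesis v_nsq : forall x, x ^+ 2 != v.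
Hypothesis zeta4 : zeta ^+ 4 = j (v * g ^+ 2).

Lemma sqr_indep x y : x ^+ 2 = y ^+ 2 * v -> x = 0 /\ y = 0.
Proof.
have [-> /eqP|y0 E] := eqVneq y 0.
  by rewrite expr0n mul0r sqrf_eq0 => /eqP.
case/eqP: (v_nsq (x / y)); rewrite exprMn E exprVn mulrAC divff ?mul1r //.
by rewrite sqrf_eq0.
Qed.

(* With w = zeta^2 / g a square root of v, a relation (a + a' w) + (c + d w) zeta
   = 0 gives N(a + a' w)^2 = - v g^2 N(c + d w)^2, and -1 is a square. *)
Lemma quartic_indep4 a0 a1 a2 a3 :
    j a0 + j a1 * zeta + j a2 * zeta ^+ 2 + j a3 * zeta ^+ 3 = 0 ->
  [/\ a0 = 0, a1 = 0, a2 = 0 & a3 = 0].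
Proof.
move=> E; pose w := zeta ^+ 2 / j g.
have jg0 : j g != 0 by rewrite fmorph_eq0.
have Ew : zeta ^+ 2 = j g * w by rewrite mulrC divfK.
have w2 : w ^+ 2 = j v.
  rewrite exprMn -exprM zeta4 rmorphM exprVn rmorphXn mulfK //.
  by rewrite sqrf_eq0.
have lin x y : j x + j y * w = 0 -> x = 0 /\ y = 0.
  move=> Exy; have /(fmorph_inj j)/sqr_indep // : j (x ^+ 2) = j (y ^+ 2 * v).
  rewrite rmorphM !rmorphXn -w2 -exprMn.
  by apply/eqP; rewrite -subr_eq0 subr_sqr Exy mulr0.
have key a a' c d : (j a + j a' * w) = - ((j c + j d * w) * zeta) ->
    [/\ a = 0, c = 0, a' = 0 & d = 0].
  move=> EA.
  have [N1 N2] : a ^+ 2 + a' ^+ 2 * v - 2 * c * d * g * v = 0 /\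
                 2 * a * a' - g * (c ^+ 2 + d ^+ 2 * v) = 0.
    apply: lin.
    rewrite !(rmorph_nat, rmorphXn, rmorphM, rmorphB, rmorphD).
    transitivity ((j a + j a' * w) ^+ 2 - (j c + j d * w) ^+ 2 * (j g * w)).
      by rewrite -w2; ring.
    by rewrite EA sqrrN exprMn Ew subrr.
  have NN : (a ^+ 2 - a' ^+ 2 * v) ^+ 2 =
      (im * g * (c ^+ 2 - d ^+ 2 * v)) ^+ 2 * v.
    transitivity ((2 * c * d * g * v) ^+ 2 - v * (g * (c ^+ 2 + d ^+ 2 * v)) ^+ 2).
      by rewrite -(subr0_eq N1) -(subr0_eq N2); ring.
    by rewrite !exprMn im2; ring.
  have im0 : im != 0 by rewrite -sqrf_eq0 im2 oppr_eq0 oner_eq0.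
  have [/eqP NA /eqP NB] := sqr_indep NN.
  move: NB; rewrite !mulf_eq0 (negbTE im0) (negbTE g0) /= subr_eq0 => /eqP.
  move=> /sqr_indep[c0 d0]; move: NA; rewrite subr_eq0 => /eqP.
  by move=> /sqr_indep[].
have [|E0 E1 /eqP E2 /eqP E3] := key a0 (a2 * g) a1 (a3 * g).
  apply/eqP; rewrite -addr_eq0 -E; apply/eqP.
  by rewrite (exprS _ 2) Ew !rmorphM; ring.
split=> //; apply/eqP.
  by move: E2; rewrite mulf_eq0 (negbTE g0) orbF.
by move: E3; rewrite mulf_eq0 (negbTE g0) orbF.
Qed.

Lemma quartic_min q : root (map_poly j q) zeta -> q != 0 -> (5 <= size q)%N.
Proof.
move=> /rootP Eq q0; rewrite ltnNge; apply: contra q0 => le.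
have : (map_poly j q).[zeta] = \sum_(i < 4) j q`_i * zeta ^+ i.
  rewrite (@horner_coef_wide _ 4) ?size_map_poly //.
  by apply: eq_bigr => i _; rewrite coef_map.
rewrite Eq !big_ord_recr big_ord0 /= add0r expr0 mulr1 expr1 => /esym.
move=> /quartic_indep4[E0 E1 E2 E3]; apply/eqP/polyP=> i; rewrite coef0.
case: i => [|[|[|[|i]]]] //; apply/nth_default/(leq_trans le); lia.
Qed.

Definition quartic : {poly F} := 'X^4 - (v * g ^+ 2)%:P.

Lemma quartic_size : size quartic = 5.
Proof. by rewrite size_XnsubC. Qed.

Lemma quartic_neq0 : quartic != 0.
Proof. by rewrite -size_poly_eq0 quartic_size. Qed.

Lemma quartic_root : root (map_poly j quartic) zeta.
Proof.
rewrite /root rmorphB /= map_polyXn map_polyC.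
by rewrite hornerD hornerN hornerXn hornerC zeta4 subrr.
Qed.

Lemma quartic_extension :
  exists (L : fieldExtType F) (z : L) (iota : {rmorphism L -> Omega}),
    [/\ forall a, iota a%:A = j a, iota z = zeta,
        forall x, exists q, x = (map_poly (in_alg L) q).[z] &
        \dim {:L} = 4].
Proof.
have [|L [z [iota [H1 H2 H3 H4]]]] :=
    simple_extension quartic_neq0 quartic_root _.
  by rewrite quartic_size; apply: quartic_min.
by exists L, z, iota; rewrite quartic_size in H4.
Qed.

End QuarticIndependence.

(** * The Galois group of X^4 - D over a field containing sqrt(-1) *)

Section CyclicQuartic.

Variables (K : fieldType) (im D : K).
Hypothesis im2 : im ^+ 2 = -1.
Hypothesis two_neq0 : 2 != 0 :> K.
Hypothesis D_neq0 : D != 0.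

Lemma quartic_roots (L : fieldExtType K) (z : L) : z ^+ 4 = D%:A ->
  let rs := [:: z; im%:A * z; - z; - (im%:A * z)] in
  uniq rs /\ 'X^4 - (D%:A)%:P = \prod_(r <- rs) ('X - r%:P).
Proof.
move=> z4 /=; set I : L := im%:A.
have I2 : I ^+ 2 = -1 by rewrite exprZn expr1n im2 scaleN1r.
have n2 : 2 != 0 :> L by rewrite -(rmorph_nat (in_alg L)) fmorph_eq0.
have z0 : z != 0.
  apply: contra_neq D_neq0 => z0; apply: (fmorph_inj (in_alg L)).
  by rewrite rmorph0 /= -z4 z0 expr0n.
have dbl (x : L) : x != 0 -> x != - x.
  by move=> x0; rewrite -addr_eq0 -mulr2n -mulr_natl mulf_neq0.
have nI e : e ^+ 2 = 1 -> (z == e * (I * z)) = false.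
  move=> e2; apply/negP=> /eqP /(congr1 (fun x => x ^+ 2)).
  rewrite !exprMn e2 I2 mul1r mulN1r => /eqP; apply/negP.
  by apply: dbl; rewrite expf_neq0.
have nI1 := nI 1 (expr1n _ _); have nI2 : (z == - (I * z)) = false.
  by rewrite -mulN1r nI // sqrrN expr1n.
rewrite mul1r in nI1.
split.
  rewrite /= !inE !negb_or nI1 nI2 dbl //= !eqr_opp nI1.
  rewrite -eqr_oppLR eq_sym nI2 /= dbl // mulf_neq0 //.
  by rewrite -sqrf_eq0 I2 oppr_eq0 oner_eq0.
rewrite !big_cons big_nil mulr1 -z4.
have IP : I%:P * I%:P = -1 :> {poly L} by rewrite -polyCM -expr2 I2 polyCN.
have -> : (z ^+ 4)%:P = z%:P ^+ 4 by rewrite rmorphXn.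
rewrite !polyCN !polyCM.
transitivity (('X ^+ 2 - z%:P ^+ 2) * ('X ^+ 2 - (I%:P * I%:P) * z%:P ^+ 2)).
  by rewrite IP; ring.
by ring.
Qed.

Lemma quartic_splitting (L : fieldExtType K) (z : L) : z ^+ 4 = D%:A ->
    <<1; z>>%VS = fullv ->
  exists p : {poly L}, [/\ p \is a polyOver 1%VS, separable_poly p &
    splittingFieldFor 1 p {:L}].
Proof.
move=> z4 gen; have [uniq_rs E] := quartic_roots z4.
exists ('X^4 - (D%:A)%:P); split.
- by rewrite rpredB ?rpredX ?polyOverX // polyOverC rpredZ ?rpred1.
- by rewrite E separable_prod_XsubC.
- exists [:: z; im%:A * z; - z; - (im%:A * z)]; first by rewrite E eqpxx.
  apply/eqP; rewrite eqEsubv subvf -gen /=.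
  by apply/FadjoinP; rewrite sub1v seqv_sub_adjoin // inE eqxx.
Qed.

Lemma quartic_C4 (L : splittingFieldType K) (z : L) : z ^+ 4 = D%:A ->
    <<1; z>>%VS = fullv -> \dim {:L} = 4 ->
  is_C4_extension L /\ exists tau : {rmorphism L -> L},
    (forall a, tau a%:A = a%:A) /\ tau z = im%:A * z.
Proof.
move=> z4 gen dim4.
have gal : galois 1 {:L}.
  by apply/splitting_galoisField; exact: quartic_splitting z4 gen.
have [/and3P[_ _ nor] card4] := (gal, galois_dim gal).
rewrite dim4 dimv1 divn1 in card4.
have [uniq_rs E] := quartic_roots z4.
have Emin : minPoly 1 z = 'X^4 - (D%:A)%:P.
  have mon : 'X^4 - (D%:A)%:P \is @monic L by rewrite monicXnsubC.
  apply/eqP; rewrite -eqp_monic ?monic_minPoly //.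
  have dv : minPoly 1 z %| 'X^4 - (D%:A)%:P.
    apply: minPoly_dvdp.
      by rewrite rpredB ?rpredX ?polyOverX // polyOverC rpredZ ?rpred1.
    by rewrite /root hornerD hornerN hornerXn hornerC z4 subrr.
  rewrite -(dvdp_size_eqp dv) size_minPoly size_XnsubC //.
  by rewrite adjoin_degreeE gen dim4 dimv1.
have [|tau gtau tauz] :=
    normalField_root_minPoly (sub1v _) nor (memvf z) (b := im%:A * z).
  by rewrite Emin E root_prod_XsubC !inE eqxx orbT.
have tauK a : tau a%:A = a%:A.
  by apply: (fixed_gal (sub1v _) gtau); rewrite rpredZ ?rpred1.
split; last by exists (tau : {rmorphism _ -> _}).
split=> //.
have ord4 : #[tau]%g = 4.
  have : (#[tau]%g %| 4)%N by have := order_dvdG gtau; rewrite -card4.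
  (* tau^2 sends z to im^2 z = - z, a different root. *)
  have : ~~ (#[tau]%g %| 2)%N.
    rewrite order_dvdn; apply/eqP => t2.
    have := gal_id {:L}%AS z; rewrite -t2 expgS expg1 galM ?memvf // tauz.
    rewrite rmorphM /= tauK tauz mulrA -scalerAl mul1r scalerA -expr2 im2 => /eqP.
    rewrite scaleN1r mulN1r eq_sym; apply/negP.
    move: uniq_rs; rewrite /= !inE !negb_or => /and4P[/and3P[_ + _] _ _ _].
    by [].
  by case: #[tau]%g => [|[|[|[|[|n]]]]] // _ /dvdn_leq; move=> /(_ isT).
have cyc : ('Gal({:L} / 1) = <[tau]>)%g.
  by apply/eqP; rewrite eq_sym eqEcard cycle_subG gtau /= -card4 -orderE ord4.
rewrite /= cyc isog_cyclic_card ?cycle_cyclic // card_Zp // -orderE ord4 eqxx.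
by rewrite andbT; apply/cyclicP; exists (inZp 1); exact: Zp_cycle 3.
Qed.

End CyclicQuartic.

(** * The point on the curve *)

Lemma nsquare_mul4 (F : fieldType) (p k : nat) : 2 != 0 :> F ->
  (forall x : F, x ^+ 2 != p%:R) -> forall x : F, x ^+ 2 != (p * 4 ^ k)%:R.
Proof.
move=> n2 p_nsq x; apply/eqP=> E; case/eqP: (p_nsq (x / 2 ^+ k)).
rewrite exprMn E natrM natrX exprVn -exprM mulnC exprM.
have -> : 4 = 2 ^+ 2 :> F by rewrite -natrX.
by rewrite mulfK // !expf_neq0.
Qed.

Section QuarticPoint.

Variables (K : fieldExtType rat) (b im : K) (k p : nat).
Hypothesis b_neq0 : b <> 0.
Hypothesis b_neqN4 : b <> - 4.
Hypothesis im2 : im ^+ 2 = -1.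
Hypothesis b_dyadic : dyadic_int (2 ^+ k * b).
Hypothesis p_nsq : forall x : K, x ^+ 2 != p%:R.

Definition quartic_v : nat := (p * 4 ^ k.+1)%N.
Local Notation v := (quartic_v%:R : K).
Definition quartic_g : K := v ^+ 2 + (2 + b) * v + 1.
Local Notation g := quartic_g.

Lemma quartic_vE : v = 2 * (2 * 4 ^ k * p)%:R.
Proof. by rewrite -natrM /quartic_v; congr _%:R; rewrite expnS; lia. Qed.

(** This explains the exponent k + 1: of the factors 2 in 4^(k+1), k clear the denominator of b and
    one makes the product even. *)
Lemma quartic_vb : v * b = 2 * ((2 ^+ k.+1 * p%:R) * (2 ^+ k * b)).
Proof.
have -> : v = p%:R * 4 ^+ k.+1 by rewrite /quartic_v natrM natrX.
have -> : 4 ^+ k.+1 = 2 ^+ k.+1 * 2 ^+ k.+1 :> K.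
  by rewrite -exprMn -natrM.
by rewrite [in X in p%:R * (_ * X)]exprS; ring.
Qed.

(** Both v and v b are even, so g is 1 modulo 2. *)
Lemma quartic_g_neq0 : g != 0.
Proof.
have dyK := dyadic_int_ring K.
pose c := 2 * (2 * 4 ^ k * p)%:R ^+ 2 + 2 * (2 * 4 ^ k * p)%:R +
  (2 ^+ k.+1 * p%:R) * (2 ^+ k * b).
have [|c0 _] := @dyadicV _ _ dyK c.
  apply: (dyadicD dyK); last first.
    apply: (dyadicM dyK) => //; rewrite -natrX -natrM; exact: (dyadic_nat dyK).
  by apply: (dyadicD dyK); rewrite -?natrX -natrM; apply: (dyadic_nat dyK).
suff -> : g = 1 + 2 * c by [].
by rewrite /quartic_g mulrDl [b * _]mulrC quartic_vb quartic_vE /c; ring.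
Qed.

Lemma quartic_v_nsq (x : K) : x ^+ 2 != v.
Proof.
apply: nsquare_mul4 p_nsq _.
exact: dyadic_two_neq0 (dyadic_int_ring K).
Qed.

Variables (L : fieldExtType K) (z : L) (tau : {rmorphism L -> L}).
Hypothesis z4 : z ^+ 4 = (v * g ^+ 2)%:A.
Hypothesis tauK : forall a : K, tau a%:A = a%:A.
Hypothesis tauz : tau z = im%:A * z.

Local Notation bL := (b%:A : L).
Local Notation phi := (in_alg L).
Let w : L := z ^+ 2 / g%:A.
Let x : L := w + w^-1.
Let y : L := (1 + w) * z / w ^+ 2.

Let gL0 : g%:A != 0 :> L.
Proof. by rewrite (fmorph_eq0 phi) quartic_g_neq0. Qed.

Let w2 : w ^+ 2 = quartic_v%:R.
Proof.
rewrite /w exprMn -exprM z4 exprVn -[_%:A]/(phi _) -[g%:A]/(phi g).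
rewrite -rmorphXn -fmorphV -rmorphM mulfK ?expf_neq0 ?quartic_g_neq0 //.
by rewrite rmorph_nat.
Qed.

Let v0 : quartic_v%:R != 0 :> L.
Proof.
rewrite -(rmorph_nat phi) fmorph_eq0; apply: contraT; rewrite negbK => /eqP E.
by have := quartic_v_nsq 0; rewrite expr0n E eqxx.
Qed.

Let w0 : w != 0.
Proof. by rewrite -sqrf_eq0 w2. Qed.

Let z2 : z ^+ 2 = g%:A * w.
Proof. by rewrite /w mulrC divfK. Qed.

Let gE : g%:A = w ^+ 4 + (2 + bL) * w ^+ 2 + 1.
Proof.
have phiv : v%:A = w ^+ 2 by rewrite w2 -(rmorph_nat phi).
rewrite -[g%:A]/(phi g) /quartic_g (rmorphD phi) (rmorphD phi) (rmorphXn phi).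
rewrite (rmorphM phi) (rmorphD phi) (rmorph_nat phi 2) rmorph1 /= phiv.
by rewrite -exprM.
Qed.

Lemma quartic_point_on_curve : on_curve bL (Some (x, y)).
Proof.
apply/eqP; rewrite /y /x; move: w w0 z2 gE => w' w'0 Ez Eg.
by rewrite !exprMn Ez Eg; field.
Qed.

Lemma quartic_ns : 2 * b * (b + 4) != 0.
Proof.
rewrite !mulf_neq0 //; last by rewrite addr_eq0; apply/eqP.
  exact: dyadic_two_neq0 (dyadic_int_ring K).
exact/eqP.
Qed.

Lemma quartic_nsL : 2 * bL * (bL + 4) != 0.
Proof.
have [n2 n0 n4] := disc_factors quartic_ns; rewrite !mulf_neq0 //.
- by rewrite -(rmorph_nat phi) fmorph_eq0.
- by rewrite (fmorph_eq0 phi).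
- by rewrite -(rmorph_nat phi 4) -(rmorphD phi) fmorph_eq0.
Qed.

Let P : ec_group quartic_nsL := ECPoint quartic_point_on_curve.

(** The criterion looks only at the abscissa, which lies in K(w) = K(s) with s^2 = p; the ring O + O
    s is therefore enough although the ordinate involves z. Concretely 1/x = w / (1 + v) with w =
    2^(k+1) s, and b / x^2 = v b / (1 + v)^2 is even. *)
Lemma quartic_point_ntors n : P *+ n.+1 <> 0.
Proof.
have dyK := dyadic_int_ring K.
have n2 : 2 != 0 :> K := dyadic_two_neq0 dyK.
have n2L : 2 != 0 :> L by rewrite -(rmorph_nat phi) fmorph_eq0.
pose s : L := w / 2 ^+ k.+1.
have s2 : s ^+ 2 = p%:R.
  rewrite /s exprMn w2 /quartic_v natrM natrX exprVn -exprM mulnC exprM.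
  have -> : 4 = 2 ^+ 2 :> L by rewrite -natrX.
  by rewrite mulfK // !expf_neq0.
have sN a : phi a != s.
  apply: contra_neq (p_nsq a) => Ea; apply: (fmorph_inj phi).
  transitivity (s ^+ 2); first by rewrite -Ea (rmorphXn phi).
  by rewrite s2 (rmorph_nat phi).
have dyL := dyadic_quadratic dyK s2 sN.
have [v1 Ov1] : 1 + v != 0 /\ dyadic_int (1 + v)^-1.
  by rewrite quartic_vE; apply: (dyadicV dyK); apply: (dyadic_nat dyK).
have v1L : 1 + w ^+ 2 != 0.
  by rewrite w2 -(rmorph_nat phi) -(rmorph1 phi) -rmorphD fmorph_eq0.
have xE : x^-1 = w / (1 + w ^+ 2).
  have -> : x = (1 + w ^+ 2) / w by rewrite mulrDl mul1r expr2 mulfK // addrC.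
  by rewrite invf_div.
have wE : w = 2 ^+ k.+1 * s by rewrite /s mulrC divfK ?expf_neq0.
have x0 : x != 0 by rewrite -invr_eq0 xE mulf_neq0 ?invr_eq0.
have vE' : (1 + w ^+ 2)^-1 = phi (1 + v)^-1.
  by rewrite (fmorphV phi) (rmorphD phi) (rmorph1 phi) (rmorph_nat phi) w2.
apply: (ec_dyadic_ntors dyL (x := x) (y := y)
   (c := phi ((2 ^+ k.+1 * p%:R) * (2 ^+ k * b) * (1 + v)^-1 ^+ 2))) => //.
- exists 0, (2 ^+ k.+1 / (1 + v)); split; first exact: (dyadic0 dyK).
    apply: (dyadicM dyK) => //; apply: (dyadicX dyK) => //.
    exact: (dyadic_nat dyK).
  have E : phi (2 ^+ k.+1 / (1 + v)) = 2 ^+ k.+1 * (1 + w ^+ 2)^-1.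
    by rewrite vE' (rmorphM phi) (rmorphXn phi) (rmorph_nat phi).
  rewrite (rmorph0 phi) add0r xE; apply: etrans (congr1 ( *%R^~ s) (esym E)).
  by rewrite {1}wE mulrAC.
- exists ((2 ^+ k.+1 * p%:R) * (2 ^+ k * b) * (1 + v)^-1 ^+ 2), 0.
  rewrite (rmorph0 phi) mul0r addr0; split=> //; last exact: (dyadic0 dyK).
  apply: (dyadicM dyK); last exact: (dyadicX dyK).
  by apply: (dyadicM dyK) => //; rewrite -natrX -natrM; apply: (dyadic_nat dyK).
- rewrite xE vE' exprMn w2 -[bL]/(phi b) -(rmorph_nat phi) -(rmorph_nat phi 2).
  rewrite -(rmorphXn phi) -!(rmorphM phi); congr (phi _).
  by rewrite mulrA [b * v]mulrC quartic_vb; ring.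
Qed.

Lemma quartic_rank : (ec_rank b + (Posz 2)%:E <= ec_rank bL)%E.
Proof.
have bE : phi b = bL by [].
pose f := @ec_group_map _ _ phi b bL bE quartic_ns quartic_nsL.
pose t := @ec_group_map _ _ tau bL bL (tauK b) quartic_nsL quartic_nsL.
have tauw : tau w = - w.
  rewrite /w fmorph_div rmorphXn tauK tauz exprMn.
  by rewrite exprZn expr1n im2 scaleN1r mulN1r mulNr.
have tau2z : tau (tau z) = - z.
  by rewrite tauz rmorphM tauK tauz mulrA -expr2 exprZn expr1n im2 scaleN1r mulN1r.
have tau2w : tau (tau w) = w by rewrite !(tauw, rmorphN) opprK.
have t2P : t (t P) = - P.
  apply: val_inj => /=; congr (Some (_, _)).
    by rewrite /x !rmorphD !fmorphV tau2w.
  rewrite /y; move: w tau2w => w' E'.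
  by rewrite !(rmorphXn, fmorphV, rmorphM, rmorphD, rmorph1) E' tau2z mulrN mulNr.
have tf q : t (f q) = f q.
  apply: val_inj => /=; case: q => [[[xq yq]|]] H //=.
  by rewrite !tauK.
apply: ec_rank_lt2 => r q /(ec_indepE (nsing := quartic_ns)) Iq.
exists (extend2 P (t P) (fun i => f (q i))).
apply/(ec_indepE (nsing := quartic_nsL)).
apply: indep_extend2 => //; first exact: ec_map_inj.
exact: quartic_point_ntors.
Qed.

End QuarticPoint.

(** * The sequence of extensions *)

Lemma quartic_coords (F Omega : fieldType) (j : {rmorphism F -> Omega})
    (v g : F) (zeta : Omega) (q : {poly F}) : zeta ^+ 4 = j (v * g ^+ 2) ->
  exists r : 'I_4 -> F, (map_poly j q).[zeta] = \sum_(i < 4) j (r i) * zeta ^+ i.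
Proof.
move=> z4; pose m := quartic v g; exists (fun i => (q %% m)`_i).
have sm : (size (q %% m)%R <= 4)%N.
  by have := ltn_modpN0 q (quartic_neq0 v g); rewrite quartic_size.
rewrite {1}(divp_eq q m) rmorphD rmorphM hornerD hornerM /=.
rewrite (rootP (quartic_root z4)) mulr0 add0r.
rewrite (@horner_coef_wide _ 4) ?size_map_poly //.
by apply: eq_bigr => i _; rewrite coef_map.
Qed.

Lemma lin_disjoint_sub (Omega : fieldType) (k A B B' : set Omega) :
  (forall x, B x -> B' x) -> linearly_disjoint k A B' -> linearly_disjoint k A B.
Proof. by move=> BB' H n a Aa Ia c Bc; apply: H => // i; apply: BB'. Qed.

(** * Linear disjointness through coordinates on powers of one element *)

Section LinearDisjoint.

Variables (K N Omega : fieldType).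
Variables (sigma : {rmorphism K -> Omega}) (j : {rmorphism N -> Omega}).
Hypothesis KN : forall x, exists y, j y = sigma x.
Variables (A : set Omega) (zeta : Omega) (d : nat).
Hypothesis A_coords : forall x, A x ->
  exists r : 'I_d -> K, x = \sum_(i < d) sigma (r i) * zeta ^+ i.
Hypothesis zeta_indep : forall r : 'I_d -> N,
  \sum_(i < d) j (r i) * zeta ^+ i = 0 -> forall i, r i = 0.

(** Elements of A independent over K have a coordinate matrix over K with independent rows, and this
    rank survives the passage to Omega. A relation with coefficients in N is read off on the powers
    of zeta, independent over N, and so kills the matrix from the left. *)
Lemma lin_disjoint_powers : linearly_disjoint (range sigma) A (range j).
Proof.
move=> n a Aa Ia c jc E.
have [r Er] := fin_all_exists (fun i => A_coords (Aa i)).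
have /fin_all_exists[c' Ec] i : exists x, c i = j x.
  by have [x _ <-] := jc i; exists x.
pose M : 'M[K]_(n, d) := \matrix_(i, l) r i l.
have rfM : row_free M.
  apply: inj_row_free => u uM; apply/rowP=> i; rewrite mxE.
  apply: (fmorph_inj sigma); rewrite rmorph0.
  apply: (Ia (fun i => sigma (u 0 i))) => [l|]; first by exists (u 0 l).
  transitivity (\sum_(l < d) sigma ((u *m M) 0 l) * zeta ^+ l).
    under eq_bigr do rewrite Er mulr_sumr.
    rewrite exchange_big; apply: eq_bigr => l _.
    rewrite mxE rmorph_sum mulr_suml; apply: eq_bigr => i' _.
    by rewrite rmorphM mulrA mxE.
  by rewrite uM big1 // => l _; rewrite mxE rmorph0 mul0r.
pose cv : 'rV[Omega]_n := \row_i c i.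
have cM : cv *m map_mx sigma M = 0.
  apply/rowP=> l; rewrite !mxE.
  have [m Em] : exists m : 'I_n -> 'I_d -> N, forall i l, j (m i l) = sigma (r i l).
    by have := KN; move=> /choice[h Hh]; exists (fun i l => h (r i l)).
  have /zeta_indep/(_ l) H : \sum_(l < d) j (\sum_i c' i * m i l) * zeta ^+ l = 0.
    rewrite -[RHS]E; under [RHS]eq_bigr do rewrite Er mulr_sumr.
    rewrite exchange_big; apply: eq_bigr => l' _.
    rewrite rmorph_sum mulr_suml; apply: eq_bigr => i _.
    by rewrite rmorphM Em Ec mulrA.
  rewrite -[RHS](rmorph0 j) -H rmorph_sum; apply: eq_bigr => i _.
  by rewrite !mxE rmorphM Em Ec.
have /row_free_inj inj : row_free (map_mx sigma M) by rewrite row_free_map.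
have /inj /rowP H : cv *m map_mx sigma M = 0 *m map_mx sigma M.
  by rewrite mul0mx.
by move=> i; have := H i; rewrite !mxE.
Qed.

End LinearDisjoint.

Section Construction.

Variables (K : fieldExtType rat) (b : K).
Hypothesis b_neq0 : b <> 0.
Hypothesis b_neqN4 : b <> - 4.
Variable im : K.
Hypothesis im2 : im ^+ 2 = -1.
Variables (Omega : closedFieldType) (sigma : {rmorphism K -> Omega}).

(** The field is kept as an extension of the rationals, the form to which [exists_prime_nsquare]
    applies; that it contains K is expressed by images in Omega. *)
Record tower := Tower {
  tower_field : fieldExtType rat;
  tower_inj : {rmorphism tower_field -> Omega};
  tower_base : forall x, exists y, tower_inj y = sigma x
}.

Record C4_layer := C4Layer {
  layer_field : splittingFieldType K;
  layer_inj : {rmorphism layer_field -> Omega};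
  layer_tower : tower
}.

Definition layer_spec (t : tower) (l : C4_layer) : Prop :=
  [/\ forall x : K, layer_inj l x%:A = sigma x,
      is_C4_extension (layer_field l),
      linearly_disjoint (range sigma) (range (layer_inj l))
        (range (tower_inj t)),
      (ec_rank b + (Posz 2)%:E <= ec_rank (b%:A : layer_field l))%E
    & (forall y, range (tower_inj t) y -> range (tower_inj (layer_tower l)) y) /\
      (forall y, range (layer_inj l) y -> range (tower_inj (layer_tower l)) y)].

Lemma exists_layer t : exists l, layer_spec t l.
Proof.
case: t => N j KN.
have [k bk] := dyadic_int_scale b.
have [p pp pN] := exists_prime_nsquare N.
have pK (x : K) : x ^+ 2 != p%:R.
  apply/eqP=> E; have [y Ey] := KN x; case/eqP: (pN y).
  by apply: (fmorph_inj j); rewrite rmorphXn Ey -rmorphXn E !rmorph_nat.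
have vK := quartic_v_nsq k pK; have g0 := quartic_g_neq0 p bk.
set v := quartic_v k p in vK; set g := quartic_g b k p in g0.
have n2 : 2 != 0 :> K := dyadic_two_neq0 (dyadic_int_ring K).
have v0 : v%:R != 0 :> K.
  by apply: contraT; rewrite negbK => /eqP E; have := vK 0; rewrite expr0n E eqxx.
have D0 : v%:R * g ^+ 2 != 0 by rewrite mulf_neq0 ?expf_neq0.
(* The same root is used twice: K(zeta) is the new layer and N(zeta) the next field of the tower, so
   the second contains the image of the first. *)
have [zeta zeta4] : exists zeta : Omega, zeta ^+ 4 = sigma (v%:R * g ^+ 2).
  have [//|zeta Ez] := @solve_monicpoly Omega 4
    (fun i => if i == 0%N then sigma (v%:R * g ^+ 2) else 0).
  exists zeta; rewrite Ez big_ord_recl /= expr0 mulr1 big1 ?addr0 // => i _.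
  by rewrite mul0r.
have [L [z [iota [iotaK iotaz Lgen Ldim]]]] :=
  quartic_extension im2 g0 vK zeta4.
have z4 : z ^+ 4 = (v%:R * g ^+ 2)%:A.
  by apply: (fmorph_inj iota); rewrite rmorphXn iotaz zeta4 iotaK.
have gen : <<1; z>>%VS = fullv.
  apply/eqP; rewrite eqEsubv subvf; apply/subvP=> x _.
  have [q ->] := Lgen x; apply: mempx_Fadjoin.
  by apply/polyOverP=> i; rewrite coef_map rpredZ ?rpred1.
have ax : splitting_field_axiom L.
  have [P [P1 _ P3]] := quartic_splitting im2 n2 D0 z4 gen.
  by exists P.
pose SL : splittingFieldType K :=
  HB.pack L (FieldExt_isSplittingField.Build K L ax).
have [C4 [tau [tauK tauz]]] := @quartic_C4 K im _ im2 n2 D0 SL z z4 gen Ldim.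
have rk := quartic_rank b_neq0 b_neqN4 im2 bk pK z4 tauK tauz.
have [imN EimN] := KN im; have [gN EgN] := KN g.
have imN2 : imN ^+ 2 = -1.
  by apply: (fmorph_inj j); rewrite rmorphXn EimN -rmorphXn im2 !rmorphN1.
have gN0 : gN != 0.
  by rewrite -(fmorph_eq0 j) EgN fmorph_eq0.
have vN (y : N) : y ^+ 2 != v%:R.
  apply: nsquare_mul4 pN _.
  by rewrite -(fmorph_eq0 j) rmorph_nat -(rmorph_nat sigma) fmorph_eq0.
have zeta4N : zeta ^+ 4 = j (v%:R * gN ^+ 2).
  by rewrite zeta4 (rmorphM sigma) (rmorphM j) !rmorphXn EgN !rmorph_nat.
have [N' [z' [j' [j'N j'z _ _]]]] := quartic_extension imN2 gN0 vN zeta4N.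
have KN' x : exists y, j' y = sigma x.
  by have [y Ey] := KN x; exists y%:A; rewrite j'N.
pose t' := @Tower (baseFieldType N') j' KN'.
exists (@C4Layer SL iota t'); split=> //=.
- apply: (@lin_disjoint_powers K N Omega sigma j KN _ zeta 4).
    move=> _ [x _ <-]; have [q ->] := Lgen x.
    have [r Er] := quartic_coords q zeta4; exists r; rewrite -Er.
    by rewrite -horner_map /= iotaz -map_poly_comp (eq_map_poly iotaK).
  move=> r; rewrite !big_ord_recr big_ord0 /= add0r expr0 mulr1 expr1.
  move=> /(quartic_indep4 imN2 gN0 vN zeta4N)[E0 E1 E2 E3].
  case=> -[|[|[|[|m]]]] //= lt4; [move: E0|move: E1|move: E2|move: E3];
    by move=> Er; rewrite -[RHS]Er; congr r; apply: val_inj.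
- split=> y; first by case=> x _ <-; exists x%:A; rewrite ?j'N.
  case=> x _ <-; have [q ->] := Lgen x.
  rewrite -horner_map /= iotaz -map_poly_comp (eq_map_poly iotaK).
  have [r ->] := quartic_coords q zeta4.
  have [y' Ey] := fin_all_exists (fun i => KN' (r i)).
  exists (\sum_(i < 4) y' i * z' ^+ i) => //.
  rewrite rmorph_sum; apply: eq_bigr => i _.
  by rewrite rmorphM rmorphXn Ey j'z.
Qed.

Definition base_tower : tower := @Tower K sigma (fun x => ex_intro _ x erefl).

End Construction.

Theorem theorem1p3 (K : fieldExtType rat) (b : K)
    (b_neq0 : b <> 0) (b_neqN4 : b <> -4%:R)
    (sqrtN1 : exists z : K, z ^+ 2 = -1)
    (Omega : closedFieldType) (sigma : {rmorphism K -> Omega}) :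
  exists (L : nat -> splittingFieldType K)
         (iota : forall i, {rmorphism L i -> Omega}),
    [/\ forall i (x : K), iota i x%:A = sigma x,
        forall i, is_C4_extension (L i),
        linearly_disjoint_seq (range sigma) (fun i => range (iota i))
      & forall i, (ec_rank b + (Posz 2)%:E <= ec_rank (b%:A : L i))%E].
Proof.
have [im im2] := sqrtN1.
have [next nextP] := choice (exists_layer b_neq0 b_neqN4 im2 (sigma := sigma)).
(* [t n] contains K and the first n layers, and layer n is then chosen disjoint from it. *)
pose t := fix t n := if n is n'.+1 then layer_tower (next (t n'))
                     else base_tower sigma.
exists (fun n => layer_field (next (t n))), (fun n => layer_inj (next (t n))).
split=> n; try by have [] := nextP (t n).
have [_ _ disj _ _] := nextP (t n); apply: lin_disjoint_sub disj.
(* The generated subfield is tested against the image of the tower field, which is closed under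
   division and contains all generators. *)
move=> x /(_ [pred y | `[< range (tower_inj (t n)) y >]]) gen.
apply/asboolP; apply: gen => [|y].
  split; [|move=> y z /asboolP[y' _ <-] /asboolP[z' _ <-] ..]; apply/asboolP.
  - by exists 1; rewrite ?rmorph1.
  - by exists (y' - z'); rewrite ?rmorphB.
  - by exists (y' / z'); rewrite ?fmorph_div.
move=> Hy; apply/asboolP; case: Hy => [[a _ <-]|[i [lt_in Ay]]].
  by have [y' <-] := tower_base (t n) a; exists y'.
elim: n {x} lt_in => // n IH; rewrite ltnS leq_eqVlt => /orP[/eqP E|/IH].
  by have [_ _ _ _ [_]] := nextP (t n); apply; rewrite -E.
by have [_ _ _ _ [+ _]] := nextP (t n); apply.
Qed.
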